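(* Let $G$ and $H$ be finite simple graphs. The de Rham cohomology of the product graph $G\times H$, i.e. the cohomology of the complex $\Omega^*(G)\otimes\Omega^*(H)$ with derivative given by the Leibniz rule $d(fg)=(df)g+(-1)^{|f|}f(dg)$ using the exterior derivatives of $G$ and $H$, is isomorphic to the graph cohomology of $G\times H$ defined by the exterior derivative on the graph $G\times H$: $$H_{dR}^*(G\times H)\cong H^*(G\times H).$$
   Context: Product: for finite simple graphs $G,H$, the graph $G\times H$ has as vertices all pairs $(x,y)$ with $x$ a nonempty complete subgraph (simplex, identified with its vertex set) of $G$ and $y$ a nonempty complete subgraph of $H$. Two distinct vertices $(x,y)\neq(x',y')$ are adjacent iff ($x\subseteq x'$ and $y\subseteq y'$) or ($x'\subseteq x$ and $y'\subseteq y$). Graph cohomology: for a finite simple graph $G$, let the $k$-simplices be the complete subgraphs $K_{k+1}$ of $G$ (Whitney/clique complex), each with a fixed orientation. $\Omega^k(G)$ is the finite-dimensional real vector space of functions on $k$-simplices, extended antisymmetrically to orderings of their vertices, with exterior derivative $d_k:\Omega^k(G)\to\Omega^{k+1}(G)$, $d_kf(x_0,\dots,x_{k+1})=\sum_l(-1)^l f(x_0,\dots,\hat{x}_l,\dots,x_{k+1})$. $H^k(G)=\ker d_k/\operatorname{im} d_{k-1}$. De Rham complex: $\Omega^k_{dR}(G\times H)=\bigoplus_{i+j=k}\Omega^i(G)\otimes\Omega^j(H)$, where $fg$ denotes $f\otimes g$ and $|f|=i$ for $f\in\Omega^i(G)$; $H^k_{dR}(G\times H)$ is the $k$-th cohomology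 of this complex with the Leibniz derivative. All tensor products are over $\mathbb{R}$. *)

(* Defs.v *)
From HB Require Import structures.
From mathcomp Require Import all_boot all_order all_algebra perm zify.

Set Implicit Arguments.
Unset Strict Implicit.
Unset Printing Implicit Defensive.

Import GRing.Theory.
Local Open Scope ring_scope.
Local Open Scope quotient_scope.

(* The carrier is the quotient Z-module of ring_quotient, to which the scalar  *)
(* action is added.                                                            *)

Section QuotientSpace.
Variables (K : fieldType) (V : vectType K) (S : {vspace V}).

Definition lquot := Quotient.quot S.
HB.instance Definition _ := GRing.Zmodule.on lquot.

Definition lquot_pi (x : V) : lquot := \pi_(Quotient.quot S) x.

Lemma lquot_piP x y : reflect (lquot_pi x = lquot_pi y) (x - y \in S).
Proof. by rewrite Quotient.idealrBE; apply: (iffP eqP). Qed.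

Lemma lquot_pi_surj (q : lquot) : exists x, lquot_pi x = q.
Proof. by exists (repr q); rewrite /lquot_pi reprK. Qed.

Definition lquot_scale (a : K) (q : lquot) : lquot :=
  lquot_pi (a *: repr (q : Quotient.quot S)).

Lemma lquot_piZ a x : lquot_scale a (lquot_pi x) = lquot_pi (a *: x).
Proof.
apply/lquot_piP; rewrite -scalerBr rpredZ //.
by apply/lquot_piP; rewrite /lquot_pi reprK.
Qed.

Lemma lquot_piD x y : lquot_pi (x + y) = lquot_pi x + lquot_pi y.
Proof. exact: (raddfD \pi_(Quotient.quot S)). Qed.

Fact lquot_scaleA a b q :
  lquot_scale a (lquot_scale b q) = lquot_scale (a * b) q.
Proof.
by have [x <-] := lquot_pi_surj q; rewrite !lquot_piZ scalerA.
Qed.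

Fact lquot_scale1 : left_id 1 lquot_scale.
Proof. by move=> q; have [x <-] := lquot_pi_surj q; rewrite lquot_piZ scale1r. Qed.

Fact lquot_scaleDr : right_distributive lquot_scale +%R.
Proof.
move=> a q r; have [x <-] := lquot_pi_surj q; have [y <-] := lquot_pi_surj r.
by rewrite -lquot_piD !lquot_piZ scalerDr lquot_piD.
Qed.

Fact lquot_scaleDl q : {morph lquot_scale^~ q : a b / a + b}.
Proof.
move=> a b; have [x <-] := lquot_pi_surj q.
by rewrite !lquot_piZ scalerDl lquot_piD.
Qed.

HB.instance Definition _ := GRing.Zmodule_isLmodule.Build K lquot
  lquot_scaleA lquot_scale1 lquot_scaleDr lquot_scaleDl.

Fact lquot_pi_linear : linear lquot_pi.
Proof. by move=> a x y; rewrite lquot_piD -lquot_piZ. Qed.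

HB.instance Definition _ :=
  GRing.isLinear.Build K V lquot _ lquot_pi lquot_pi_linear.

End QuotientSpace.

Definition lmod_iso (K : nzRingType) (V W : lmodType K) : Prop :=
  exists f : {linear V -> W}, bijective f.

Section DirectSum.
Import VectorInternalTheory.
Variables (K : fieldType) (I : finType) (V : I -> vectType K).

Definition dsum := {dffun forall i, V i}.
HB.instance Definition _ := Choice.on dsum.

Implicit Types f g : dsum.

Definition dsum0 : dsum := [ffun i => 0 : V i].
Definition dsum_opp f : dsum := [ffun i => - f i : V i].
Definition dsum_add f g : dsum := [ffun i => f i + g i : V i].
Definition dsum_scale (a : K) f : dsum := [ffun i => a *: f i : V i].

Fact dsum_addA : associative dsum_add.
Proof. by move=> f g h; apply/ffunP=> i; rewrite !ffunE addrA. Qed.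
Fact dsum_addC : commutative dsum_add.
Proof. by move=> f g; apply/ffunP=> i; rewrite !ffunE addrC. Qed.
Fact dsum_add0 : left_id dsum0 dsum_add.
Proof. by move=> f; apply/ffunP=> i; rewrite !ffunE add0r. Qed.
Fact dsum_addN : left_inverse dsum0 dsum_opp dsum_add.
Proof. by move=> f; apply/ffunP=> i; rewrite !ffunE addNr. Qed.

HB.instance Definition _ :=
  GRing.isZmodule.Build dsum dsum_addA dsum_addC dsum_add0 dsum_addN.

Fact dsum_scaleA a b f : dsum_scale a (dsum_scale b f) = dsum_scale (a * b) f.
Proof. by apply/ffunP=> i; rewrite !ffunE scalerA. Qed.
Fact dsum_scale1 : left_id 1 dsum_scale.
Proof. by move=> f; apply/ffunP=> i; rewrite !ffunE scale1r. Qed.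
Fact dsum_scaleDr : right_distributive dsum_scale +%R.
Proof. by move=> a f g; apply/ffunP=> i; rewrite !ffunE scalerDr. Qed.
Fact dsum_scaleDl f : {morph dsum_scale^~ f : a b / a + b}.
Proof. by move=> a b; apply/ffunP=> i; rewrite !ffunE scalerDl. Qed.

HB.instance Definition _ := GRing.Zmodule_isLmodule.Build K dsum
  dsum_scaleA dsum_scale1 dsum_scaleDr dsum_scaleDl.

Lemma dsumDE f g i : (f + g) i = f i + g i. Proof. by rewrite ffunE. Qed.
Lemma dsum0E i : (0 : dsum) i = 0. Proof. by rewrite ffunE. Qed.
Lemma dsumZE a f i : (a *: f) i = a *: f i. Proof. by rewrite ffunE. Qed.
Lemma dsum_sumE (J : Type) (r : seq J) (P : pred J) (F : J -> dsum) i :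
  (\sum_(j <- r | P j) F j) i = \sum_(j <- r | P j) F j i.
Proof. by elim/big_rec2: _ => [|j _ y _ <-]; rewrite ?dsum0E ?dsumDE. Qed.

Definition dsum_in_fun i (x : V i) : dsum :=
  [ffun j => dfwith (fun j => 0 : V j) x j].

Fact dsum_in_linear i : linear (@dsum_in_fun i).
Proof.
move=> a x y; apply/ffunP=> j; rewrite dsumDE dsumZE !ffunE.
by case: (eqVneq i j) => [<-|ij]; rewrite ?dfwith_in ?dfwith_out ?scaler0 ?addr0.
Qed.
HB.instance Definition _ i :=
  GRing.isLinear.Build K (V i) dsum _ (@dsum_in_fun i) (@dsum_in_linear i).

Definition dsum_pr_fun i f : V i := f i.
Fact dsum_pr_linear i : linear (@dsum_pr_fun i).
Proof. by move=> a f g; rewrite /dsum_pr_fun dsumDE dsumZE. Qed.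
HB.instance Definition _ i :=
  GRing.isLinear.Build K dsum (V i) _ (@dsum_pr_fun i) (@dsum_pr_linear i).

Fact dsum_vect_axiom :
  Vector.axiom (\sum_(i < #|I|) dim (V (enum_val i))) dsum.
Proof.
pose h f : 'rV[K]_(\sum_(i < #|I|) dim (V (enum_val i))) :=
  \mxrow_(i < #|I|) v2r (f (enum_val i)).
pose g (r : 'rV[K]_(\sum_(i < #|I|) dim (V (enum_val i)))) : dsum :=
  \sum_(i < #|I|) dsum_in_fun (r2v (submxrow r i)).
have gE r (i : 'I_#|I|) :
    g r (enum_val i) = r2v (submxrow r i).
  rewrite /g dsum_sumE (bigD1 i) //= ffunE dfwith_in big1 ?addr0 // => j ji.
  by rewrite ffunE dfwith_out // (inj_eq enum_val_inj).
exists h; last first.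
  exists g => [f|r].
    apply/ffunP=> i; rewrite -(enum_rankK i) gE mxrowK.
    by rewrite v2rK.
  by apply/mxrowP=> i; rewrite mxrowK gE r2vK.
move=> a f f'; apply/mxrowP=> i; rewrite submxrowD mxrowK dsumDE dsumZE.
have ->: submxrow (a *: h f) i = a *: submxrow (h f) i.
  by apply/rowP=> j; rewrite !mxE.
by rewrite !mxrowK linearP.
Qed.

HB.instance Definition _ := Lmodule_hasFinDim.Build K dsum dsum_vect_axiom.
End DirectSum.

(* Over a field and in finite dimension, phi |-> phi(u) v identifies the       *)
(* tensor product of U and V with Hom(U^*, V). The universal property is       *)
(* tens_lift (existence) and tens_ext (uniqueness).                            *)

Section Tensor.
Variables (K : fieldType).
Implicit Types U V W : vectType K.

Definition tens U V : vectType K := 'Hom('Hom(U, K^o), V).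

Section Pure.
Variables U V : vectType K.

Definition pure_fun (u : U) (v : V) (phi : 'Hom(U, K^o)) : V := (phi u : K) *: v.

Fact pure_fun_linear u v : linear (pure_fun u v).
Proof. by move=> a p q; rewrite /pure_fun add_lfunE scale_lfunE scalerDl scalerA. Qed.
HB.instance Definition _ u v :=
  GRing.isLinear.Build K 'Hom(U, K^o) V _ (pure_fun u v) (pure_fun_linear u v).

Definition pure (u : U) (v : V) : tens U V := linfun (pure_fun u v).

Lemma pureE u v (phi : 'Hom(U, K^o)) : (pure u v : 'Hom(_, _)) phi = (phi u : K) *: v.
Proof. by rewrite lfunE. Qed.

Fact pure_is_linear u : linear (pure u).
Proof.
move=> a v w; apply/lfunP=> phi.
by rewrite add_lfunE scale_lfunE !pureE scalerDr !scalerA mulrC.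
Qed.
Fact pure_is_linear_l v : linear (pure^~ v).
Proof.
move=> a u w; apply/lfunP=> phi.
by rewrite add_lfunE scale_lfunE !pureE linearP scalerDl scalerA.
Qed.

Lemma pure0 u : pure u 0 = 0.
Proof. by apply/lfunP=> phi; rewrite pureE scaler0 zero_lfunE. Qed.
Lemma pure0l v : pure 0 v = 0.
Proof. by apply/lfunP=> phi; rewrite pureE linear0 scale0r zero_lfunE. Qed.

Lemma tens_sum_pure (t : tens U V) : exists (n : nat) (u : 'I_n -> U) (v : 'I_n -> V),
  t = \sum_(i < n) pure (u i) (v i).
Proof.
pose e := vbasis {:U}; pose c i : 'Hom(U, K^o) := linfun (coord e i : U -> K^o).
exists _, (tnth e), (fun i => (t : 'Hom(_, _)) (c i)).
apply/lfunP=> phi; rewrite sum_lfunE.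
have {1}->: phi = \sum_i (phi (tnth e i) : K) *: c i.
  apply/lfunP=> u; rewrite {1}(coord_vbasis (memvf u)) linear_sum sum_lfunE.
  apply: eq_bigr => i _; rewrite linearZ scale_lfunE lfunE (tnth_nth 0) /=.
  by rewrite /GRing.scale /= mulrC.
rewrite linear_sum; apply: eq_bigr => i _ /=.
by rewrite linearZ /= pureE.
Qed.

Lemma tens_ext W (h h' : 'Hom(tens U V, W)) :
  (forall u v, h (pure u v) = h' (pure u v)) -> h = h'.
Proof.
move=> eq_h; apply/lfunP=> t; have [n [u [v ->]]] := tens_sum_pure t.
rewrite !linear_sum; apply: eq_bigr => i _; exact: eq_h.
Qed.

Lemma tens_lift W (b : U -> V -> W) :
    (forall u, linear (b u)) -> (forall v, linear (b^~ v)) ->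
  exists h : 'Hom(tens U V, W), forall u v, h (pure u v) = b u v.
Proof.
move=> bl br; pose e := vbasis {:U}.
pose c i : 'Hom(U, K^o) := linfun (coord e i : U -> K^o).
pose h (t : tens U V) := \sum_i b (tnth e i) ((t : 'Hom(_, _)) (c i)).
have h_lin : linear h.
  move=> a t t'; rewrite /h scaler_sumr -big_split; apply: eq_bigr => i _ /=.
  by rewrite add_lfunE scale_lfunE bl.
pose hL := GRing.isLinear.Build K (tens U V) W _ h h_lin.
pose h' : {linear tens U V -> W} := HB.pack h hL.
exists (linfun h') => u v; rewrite lfunE /= /h.
pose bvL := GRing.isLinear.Build K U W _ (b^~ v) (br v).
pose bv : {linear U -> W} := HB.pack (b^~ v) bvL.
rewrite -[RHS]/(bv u) [in RHS](coord_vbasis (memvf u)) linear_sum; apply: eq_bigr => i _.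
rewrite linearZ /= pureE lfunE /= (tnth_nth 0) -/e.
pose buL := GRing.isLinear.Build K V W _ (b e`_i) (bl e`_i).
pose bu : {linear V -> W} := HB.pack (b e`_i) buL.
by rewrite -[b _ _]/(bu _) linearZ.
Qed.

End Pure.

Definition transp U U' (f : 'Hom(U, U')) (phi : 'Hom(U', K^o)) : 'Hom(U, K^o) :=
  (phi \o f)%VF.

Fact transp_linear U U' (f : 'Hom(U, U')) : linear (transp f).
Proof.
move=> a p q; apply/lfunP=> u.
by rewrite !(add_lfunE, scale_lfunE, comp_lfunE).
Qed.
HB.instance Definition _ U U' f := GRing.isLinear.Build K 'Hom(U', K^o)
  'Hom(U, K^o) _ (@transp U U' f) (@transp_linear U U' f).

Section TensMap.
Variables (U U' V V' : vectType K) (f : 'Hom(U, U')) (g : 'Hom(V, V')).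

Definition tens_map_fun (t : tens U V) : tens U' V' :=
  (g \o t \o linfun (transp f))%VF.

Fact tens_map_linear : linear tens_map_fun.
Proof.
move=> a s t; apply/lfunP=> u; rewrite !(add_lfunE, scale_lfunE, comp_lfunE).
by rewrite linearP.
Qed.
HB.instance Definition _ := GRing.isLinear.Build K (tens U V) (tens U' V') _
  tens_map_fun tens_map_linear.

Definition tens_map : 'Hom(tens U V, tens U' V') := linfun tens_map_fun.

Lemma tens_map_pure u v : tens_map (pure u v) = pure (f u) (g v).
Proof.
rewrite lfunE /=; apply/lfunP=> phi.
by rewrite /tens_map_fun !comp_lfunE !pureE linearZ /= lfunE /= comp_lfunE.
Qed.

End TensMap.
End Tensor.

(* Graded by nat: the term in degree -1 is 0, as reflected in coboundaries.    *)

Record cochain_complex (K : fieldType) := CochainComplex {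
  cobj : nat -> vectType K;
  cdiff : forall k, 'Hom(cobj k, cobj k.+1);
  cdiffK : forall k x, cdiff k.+1 (cdiff k x) = 0
}.

Section Cohomology.
Variables (K : fieldType) (C : cochain_complex K).

Definition cocycles k : {vspace cobj C k} := lker (cdiff C k).

Definition coboundaries k : {vspace cobj C k} :=
  if k is k'.+1 then limg (cdiff C k') else 0%VS.

Lemma sub_coboundaries k : (coboundaries k <= cocycles k)%VS.
Proof.
case: k => [|k]; first exact: sub0v.
apply/subvP=> _ /memv_imgP[x _ ->].
by rewrite memv_ker cdiffK.
Qed.

Definition cohomology k : lmodType K :=
  lquot (linfun (@vsval _ _ (cocycles k)) @^-1: coboundaries k)%VS.

End Cohomology.

(* In total degree k this is the direct sum of C^i (x) D^j over i + j = k; the  *)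
(* differential is determined by the Leibniz rule tot_leibniz (uniqueness by   *)
(* tot_ext).                                                                   *)

Section TensorComplex.
Variables (K : fieldType) (C D : cochain_complex K).

Definition bideg k := {p : 'I_k.+1 * 'I_k.+1 | (p.1 + p.2 == k)%N}.

Fact bideg_ltl k i j : (i + j)%N = k -> (i < k.+1)%N.
Proof. by move<-; rewrite ltnS leq_addr. Qed.
Fact bideg_ltr k i j : (i + j)%N = k -> (j < k.+1)%N.
Proof. by move<-; rewrite ltnS leq_addl. Qed.
Definition mkbideg k i j (e : (i + j)%N = k) : bideg k :=
  exist (fun p : 'I_k.+1 * 'I_k.+1 => (p.1 + p.2 == k)%N)
    (Ordinal (bideg_ltl e), Ordinal (bideg_ltr e)) (introT eqP e).

Definition bipart k (p : bideg k) : vectType K :=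
  tens (cobj C (val p).1) (cobj D (val p).2).

Definition tot_obj k : vectType K := dsum (@bipart k).

Definition tot_in k i j (e : (i + j)%N = k) :
    'Hom(tens (cobj C i) (cobj D j), tot_obj k) :=
  linfun (dsum_in_fun (i := mkbideg e) : bipart (mkbideg e) -> tot_obj k).

Lemma tot_inE k i j (e : (i + j)%N = k) t :
  tot_in e t = dsum_in_fun (t : bipart (mkbideg e)).
Proof.
exact: (lfunE (dsum_in_fun (i := mkbideg e) :
  {linear bipart (mkbideg e) -> tot_obj k})).
Qed.

Definition tot_pr k (p : bideg k) :
    'Hom(tot_obj k, tens (cobj C (val p).1) (cobj D (val p).2)) :=
  linfun (@dsum_pr_fun _ _ (@bipart k) p).

Lemma tot_prE k (p : bideg k) (w : tot_obj k) : tot_pr p w = w p.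
Proof.
exact: (lfunE (@dsum_pr_fun _ _ (@bipart k) p :
  {linear tot_obj k -> bipart p})).
Qed.

Fact bideg_eql k (p : bideg k) : ((val p).1.+1 + (val p).2)%N = k.+1.
Proof. by rewrite addSn (eqP (valP p)). Qed.
Fact bideg_eqr k (p : bideg k) : ((val p).1 + (val p).2.+1)%N = k.+1.
Proof. by rewrite addnS (eqP (valP p)). Qed.

Definition tot_diff k : 'Hom(tot_obj k, tot_obj k.+1) :=
  \sum_(p : bideg k)
    ((tot_in (bideg_eql p) \o tens_map (cdiff C _) \1
      + (-1) ^+ (val p).1 *: (tot_in (bideg_eqr p) \o tens_map \1 (cdiff D _)))
     \o tot_pr p)%VF.

Lemma bidegP k (p : bideg k) : exists i j (e : (i + j)%N = k), p = mkbideg e.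
Proof.
exists (val p).1, (val p).2, (eqP (valP p)); apply: val_inj.
by rewrite /= [LHS]surjective_pairing; congr pair; apply: val_inj.
Qed.

Lemma tot_ext k (W : vectType K) (h h' : 'Hom(tot_obj k, W)) :
  (forall i j (e : (i + j)%N = k) u v,
     h (tot_in e (pure u v)) = h' (tot_in e (pure u v))) -> h = h'.
Proof.
move=> eq_h; apply/lfunP=> w.
have -> : w = \sum_(p : bideg k) dsum_in_fun (w p).
  apply/ffunP=> q; rewrite dsum_sumE (bigD1 q) //= ffunE dfwith_in big1 ?addr0 //.
  by move=> p qp; rewrite ffunE dfwith_out.
rewrite !linear_sum; apply: eq_bigr => p _ /=.
move: (w p); have [i [j [e ->]]] := bidegP p => t.
rewrite -(tot_inE e t).
have: (h \o tot_in e)%VF = (h' \o tot_in e)%VF.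
  by apply: tens_ext => u v; rewrite !comp_lfunE.
by move/lfunP=> /(_ t); rewrite !comp_lfunE.
Qed.

(* tot_in e (pure f g) is the product fg of f in degree i and g in degree j.   *)
Lemma tot_leibniz k i j (e : (i + j)%N = k) (e1 : (i.+1 + j)%N = k.+1)
    (e2 : (i + j.+1)%N = k.+1) (f : cobj C i) (g : cobj D j) :
  tot_diff k (tot_in e (pure f g)) =
    tot_in e1 (pure (cdiff C i f) g)
    + (-1) ^+ i *: tot_in e2 (pure f (cdiff D j g)).
Proof.
rewrite /tot_diff sum_lfunE (bigD1 (mkbideg e)) //= big1 ?addr0; last first.
  move=> p ep; rewrite comp_lfunE.
  have ->: tot_pr p (tot_in e (pure f g)) = 0; last by rewrite linear0.
  by rewrite tot_prE tot_inE ffunE dfwith_out // eq_sym.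
rewrite comp_lfunE.
have ->: tot_pr (mkbideg e) (tot_in e (pure f g)) = pure f g.
  by rewrite tot_prE tot_inE ffunE dfwith_in.
rewrite (eq_irrelevance (bideg_eql (mkbideg e)) e1).
rewrite (eq_irrelevance (bideg_eqr (mkbideg e)) e2).
by rewrite add_lfunE scale_lfunE !comp_lfunE !tens_map_pure !id_lfunE.
Qed.

Lemma tot_diffK k x : tot_diff k.+1 (tot_diff k x) = 0.
Proof.
suff: (tot_diff k.+1 \o tot_diff k)%VF = 0.
  by move/lfunP/(_ x); rewrite comp_lfunE zero_lfunE.
apply: tot_ext => i j e f g; rewrite comp_lfunE zero_lfunE.
have e1 : (i.+1 + j)%N = k.+1 by rewrite addSn e.
have e2 : (i + j.+1)%N = k.+1 by rewrite addnS e.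
have e11 : (i.+2 + j)%N = k.+2 by rewrite addSn e1.
have e12 : (i.+1 + j.+1)%N = k.+2 by rewrite addSn e2.
have e22 : (i + j.+2)%N = k.+2 by rewrite addnS e2.
rewrite (tot_leibniz _ e1 e2) linearD linearZ /=.
rewrite (tot_leibniz _ e11 e12) (tot_leibniz _ e12 e22) !cdiffK.
rewrite pure0 pure0l.
by rewrite !linear0 addr0 add0r exprS mulN1r scaleNr addNr.
Qed.

Definition tensor_complex := CochainComplex tot_diffK.
End TensorComplex.

Record sgraph := SGraph {
  vertex :> finType;
  adj : rel vertex;
  adj_sym : symmetric adj;
  adj_irrefl : irreflexive adj
}.

(* A complete subgraph is identified with its vertex set, which is required to *)
(* be nonempty.                                                                *)
Definition simplex (G : sgraph) (A : {set G}) : bool :=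
  (A != set0) && [forall x in A, forall y in A, (x != y) ==> adj x y].

Section ProductGraph.
Variables G H : sgraph.

Definition prod_vertex : finType :=
  ({A : {set G} | simplex A} * {B : {set H} | simplex B})%type.

Definition prod_adj : rel prod_vertex := fun u v =>
  (u != v) &&
  ((val u.1 \subset val v.1) && (val u.2 \subset val v.2)
   || (val v.1 \subset val u.1) && (val v.2 \subset val u.2)).

Fact prod_adj_sym : symmetric prod_adj.
Proof. by move=> u v; rewrite /prod_adj eq_sym orbC. Qed.

Fact prod_adj_irrefl : irreflexive prod_adj.
Proof. by move=> u; rewrite /prod_adj eqxx. Qed.

Definition prod_graph : sgraph := SGraph prod_adj_sym prod_adj_irrefl.
End ProductGraph.

(* A k-form is an alternating function of the ordered k-simplices. Fixing one  *)
(* ordering of each k-simplex turns it into an arbitrary function on the set   *)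
(* of k-simplices, see form_orientation.                                       *)

Section Forms.
Variables (K : fieldType) (G : sgraph).

(* Ordered k-simplices: the orderings of the vertices of the complete          *)
(* subgraphs with k + 1 vertices.                                              *)
Definition osimplex_pred k (x : {ffun 'I_k.+1 -> G}) : bool :=
  injectiveb x && simplex [set x i | i : 'I_k.+1].

Definition osimplex k := {x : {ffun 'I_k.+1 -> G} | osimplex_pred x}.

Definition underlying k (x : osimplex k) : {set G} := [set val x i | i : 'I_k.+1].

Fact face_subproof k (x : osimplex k.+1) (l : 'I_k.+2) :
  osimplex_pred [ffun i => val x (lift l i)].
Proof.
have /andP[/injectiveP xI /andP[_ /forall_inP xC]] := valP x.
have x_in i : val x i \in [set val x j | j : 'I_k.+2] by apply: imset_f.
apply/andP; split.
  by apply/injectiveP=> i j; rewrite !ffunE => /xI /lift_inj.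
apply/andP; split.
  by apply/set0Pn; exists (val x (lift l ord0)); apply/imsetP;
     exists ord0; rewrite ?ffunE.
apply/forall_inP=> _ /imsetP[i _ ->]; apply/forall_inP=> _ /imsetP[j _ ->].
rewrite !ffunE; have /forall_inP := xC _ (x_in (lift l i)).
by apply; apply: x_in.
Qed.

(* (x_0, ..., x_{k+1}) |-> (x_0, ..., x_{l-1}, x_{l+1}, ..., x_{k+1}) *)
Definition face k (x : osimplex k.+1) (l : 'I_k.+2) : osimplex k :=
  Sub _ (face_subproof x l).

Fact reorder_subproof k (x : osimplex k) (s : 'S_k.+1) :
  osimplex_pred [ffun i => val x (s i)].
Proof.
have /andP[/injectiveP xI xC] := valP x; apply/andP; split.
  by apply/injectiveP=> i j; rewrite !ffunE => /xI /perm_inj.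
suff ->: [set [ffun i => val x (s i)] i | i : 'I_k.+1] = underlying x by [].
apply/setP=> v; apply/imsetP/imsetP=> -[i _ ->].
  by exists (s i); rewrite ?ffunE.
by exists ((s^-1)%g i); rewrite ?ffunE ?permKV.
Qed.

Definition reorder k (x : osimplex k) (s : 'S_k.+1) : osimplex k :=
  Sub _ (reorder_subproof x s).

Definition pullback_perm_fun k (s : 'S_k.+1) (f : {ffun osimplex k -> K^o}) :
    {ffun osimplex k -> K^o} :=
  [ffun x => f (reorder x s)].

Fact pullback_perm_linear k s : linear (@pullback_perm_fun k s).
Proof. by move=> a f g; apply/ffunP=> x; rewrite !ffunE. Qed.
HB.instance Definition _ k s := GRing.isLinear.Build K {ffun osimplex k -> K^o}
  {ffun osimplex k -> K^o} _ (@pullback_perm_fun k s) (@pullback_perm_linear k s).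

Definition forms k : {vspace {ffun osimplex k -> K^o}} :=
  (\bigcap_(s : 'S_k.+1)
     lker (linfun (@pullback_perm_fun k s) - (-1) ^+ s *: \1)%VF)%VS.

Lemma formsP k (f : {ffun osimplex k -> K^o}) :
  reflect (forall s x, f (reorder x s) = (-1) ^+ s * (f x : K)) (f \in forms k).
Proof.
rewrite memvE; apply: (iffP subv_bigcapP) => [fA s x | fA s _].
  have := fA s isT; rewrite -memvE memv_ker !lfun_simp /= subr_eq0.
  by move=> /eqP/ffunP/(_ x); rewrite !ffunE.
rewrite -memvE memv_ker !lfun_simp /= subr_eq0.
by apply/eqP/ffunP=> x; rewrite !ffunE fA.
Qed.

Definition ext_diff_fun k (f : {ffun osimplex k -> K^o}) :
    {ffun osimplex k.+1 -> K^o} :=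
  [ffun x => \sum_(l < k.+2) (-1) ^+ l * (f (face x l) : K)].

Fact ext_diff_linear k : linear (@ext_diff_fun k).
Proof.
move=> a f g; apply/ffunP=> x; rewrite !ffunE /=.
rewrite -[X in _ = X + _]/(a * _ : K) mulr_sumr -big_split; apply: eq_bigr => l _ /=.
by rewrite !ffunE mulrDr -[_ *: _]/(a * _) mulrCA.
Qed.
HB.instance Definition _ k := GRing.isLinear.Build K {ffun osimplex k -> K^o}
  {ffun osimplex k.+1 -> K^o} _ (@ext_diff_fun k) (@ext_diff_linear k).

Lemma unlift_perm n (s : 'S_n.+1) (l : 'I_n.+1) :
  exists t : 'S_n, s = lift_perm l (s l) t.
Proof.
have tP (i : 'I_n) : exists j, s (lift l i) = lift (s l) j.
  case: (unliftP (s l) (s (lift l i))) => [j ->|]; first by exists j.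
  by move/perm_inj/eqP; rewrite eq_sym (negPf (neq_lift _ _)).
pose t i := odflt i (unlift (s l) (s (lift l i))).
have tE i : lift (s l) (t i) = s (lift l i).
  by rewrite /t; have [j ->] := tP i; rewrite liftK.
have tI : injective t.
  by move=> i j eq_t; apply: (@lift_inj _ l); apply: (@perm_inj _ s); rewrite -!tE eq_t.
exists (perm tI); apply/permP=> i; case: (unliftP l i) => [j ->|->].
  by rewrite lift_perm_lift permE tE.
by rewrite lift_perm_id.
Qed.

Lemma ext_diff_forms k f : f \in forms k -> ext_diff_fun f \in forms k.+1.
Proof.
move/formsP=> fA; apply/formsP=> s x; rewrite !ffunE.
rewrite [RHS]mulr_sumr [RHS](reindex_inj (@perm_inj _ s)); apply: eq_bigr => l _ /=.
have [t st] := unlift_perm s l.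
have ->: face (reorder x s) l = reorder (face x (s l)) t.
  by apply: val_inj; apply/ffunP=> i; rewrite !ffunE {1}st lift_perm_lift.
rewrite fA mulrA [RHS]mulrA; congr (_ * _).
have -> : odd_perm s = odd l (+) odd (s l) (+) t by rewrite {1}st odd_lift_perm.
rewrite -(signr_odd _ l) -(signr_odd _ (s l)).
move: (odd l) (odd (s l)) (odd_perm t) => [] [] [] /=;
  by rewrite ?expr1 ?expr0 ?mulrNN ?mulr1 ?mul1r ?mulN1r ?opprK.
Qed.

Definition ext_diff k : 'Hom(subvs_of (forms k), subvs_of (forms k.+1)) :=
  (linfun (vsproj (forms k.+1)) \o linfun (@ext_diff_fun k) \o linfun vsval)%VF.

Lemma ext_diffE k (f : subvs_of (forms k)) (x : osimplex k.+1) :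
  vsval (ext_diff k f) x =
    \sum_(l < k.+2) (-1) ^+ l * (vsval f (face x l) : K).
Proof.
rewrite !comp_lfunE !lfunE /= vsprojK ?ffunE //.
exact/ext_diff_forms/subvsP.
Qed.

Lemma ext_diffK k f : ext_diff k.+1 (ext_diff k f) = 0.
Proof.
apply: val_inj; apply/ffunP=> x; rewrite ext_diffE /= ffunE.
under eq_bigr do rewrite ext_diffE mulr_sumr.
rewrite pair_big /=.
pose F (p : 'I_k.+3 * 'I_k.+2) : K :=
  (-1) ^+ p.1 * ((-1) ^+ p.2 * vsval f (face (face x p.1) p.2)).
have unb (m : 'I_k.+3) (l : 'I_k.+2) : (unbump l m < k.+2)%N.
  by have := ltn_ord m; have := ltn_ord l; rewrite /unbump; case: ltnP; lia.
pose h (p : 'I_k.+3 * 'I_k.+2) : 'I_k.+3 * 'I_k.+2 :=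
  (lift p.1 p.2, Ordinal (unb p.1 p.2)).
have hF p : F (h p) = - F p.
  case: p => m l; rewrite /F /h /= !mulrA -mulNr; congr (_ * vsval f _).
    rewrite -!exprD -[RHS]mulN1r -exprS -signr_odd -[RHS]signr_odd; congr (_ ^+ _).
    by rewrite /bump /unbump; case: (ltnP l m); lia.
  apply: val_inj; apply/ffunP=> i; rewrite !ffunE; congr (val x _).
  by apply: val_inj; rewrite /= -bumpC.
have hK : involutive h.
  case=> m l; congr pair; apply: val_inj; rewrite /= /bump /unbump.
    by case: (ltnP l m); case: (leqP m l) => //; lia.
  by case: (ltnP l m); case: (leqP m l) => //; lia.
rewrite (bigID (fun p : 'I_k.+3 * 'I_k.+2 => (p.2 < p.1)%N)) /=.
rewrite [X in _ + X](reindex_inj (inv_inj hK)) /= -[X in X + _]/(\sum_(p | _) F p).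
rewrite [X in _ + X](eq_bigl (fun p : 'I_k.+3 * 'I_k.+2 => (p.2 < p.1)%N)).
  rewrite [X in _ + X](eq_bigr (fun p => - F p)) => [|p _]; last exact: hF.
  by rewrite sumrN subrr.
by case=> m l /=; rewrite /bump /unbump; case: (ltnP l m); lia.
Qed.

Definition ksimplex k := {A : {set G} | simplex A && (#|A| == k.+1)}.

Fact underlying_subproof k (x : osimplex k) :
  simplex (underlying x) && (#|underlying x| == k.+1).
Proof.
have /andP[/injectiveP xI ->] := valP x.
by rewrite card_imset // card_ord eqxx.
Qed.

Lemma reorder_exists k (x y : osimplex k) :
  underlying x = underlying y -> exists s, x = reorder y s.
Proof.
move=> xy; have /andP[/injectiveP xI _] := valP x.
have /fin_all_exists[t tE] (i : 'I_k.+1) : exists j, val x i = val y j.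
  have: val x i \in underlying y by rewrite -xy; apply: imset_f.
  by case/imsetP=> j _ ->; exists j.
have tI : injective t by move=> i j tij; apply: xI; rewrite !tE tij.
by exists (perm tI); apply/val_inj/ffunP=> i; rewrite ffunE permE tE.
Qed.

Lemma reorder_inj k (x : osimplex k) : injective (reorder x).
Proof.
have /andP[/injectiveP xI _] := valP x.
move=> s t /(congr1 val)/ffunP st; apply/permP=> i; apply: xI.
by have := st i; rewrite !ffunE.
Qed.

Lemma form_orientation k (o : ksimplex k -> osimplex k) (c : ksimplex k -> K) :
    (forall A, underlying (o A) = val A) ->
  exists! f : subvs_of (forms k), forall A, vsval f (o A) = c A.
Proof.
move=> oE; pose supp (x : osimplex k) : ksimplex k :=
  exist _ (underlying x) (underlying_subproof x).
have sP x : exists s, x == reorder (o (supp x)) s.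
  have [|s xs] := @reorder_exists k x (o (supp x)); first by rewrite oE.
  by exists s; apply/eqP.
pose sg x := xchoose (sP x).
have sgE x : x = reorder (o (supp x)) (sg x) by apply/eqP/(xchooseP (sP x)).
pose f := [ffun x : osimplex k => (-1) ^+ sg x * c (supp x) : K^o].
have fA : f \in forms k.
  apply/formsP=> s x; rewrite !ffunE.
  have sx : supp (reorder x s) = supp x.
    apply: val_inj; rewrite /= /underlying; apply/setP=> v.
    apply/imsetP/imsetP=> -[i _ ->]; first by exists (s i); rewrite ?ffunE.
    by exists ((s^-1)%g i); rewrite ?ffunE ?permKV.
  have -> : sg (reorder x s) = (s * sg x)%g.
    apply: (@reorder_inj _ (o (supp x))); rewrite -{1}sx -sgE {1}(sgE x).
    by apply: val_inj; apply/ffunP=> i; rewrite !ffunE permM.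
  by rewrite sx odd_permM signr_addb mulrA.
exists (Subvs fA); split.
  move=> A /=; rewrite ffunE; have oA : supp (o A) = A by apply: val_inj; apply: oE.
  have -> : sg (o A) = 1%g.
    apply: (@reorder_inj _ (o (supp (o A)))); rewrite -sgE oA.
    by apply: val_inj; apply/ffunP=> i; rewrite ffunE perm1.
  by rewrite oA odd_perm1 mul1r.
move=> f' f'E; apply: val_inj; apply/ffunP=> x; rewrite /= ffunE.
by rewrite [in RHS](sgE x) (formsP _ (subvsP f')) f'E.
Qed.

Definition form_complex : cochain_complex K := CochainComplex ext_diffK.

End Forms.

Definition de_rham_complex (K : fieldType) (G H : sgraph) : cochain_complex K :=
  tensor_complex (form_complex K G) (form_complex K H).

(* Main.v *)
(* Both complexes are dual to chain complexes with a basis of cells: pairs of  *)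
(* simplices on the de Rham side, and chains of the poset of such pairs (the   *)
(* simplices of G x H) on the other. The cells lying below a fixed pair (x, y) *)
(* span a subcomplex that contracts to a point: in the product of the two      *)
(* simplices by coning from a vertex of each factor, and in the poset because  *)
(* (x, y) is the largest element. By the method of acyclic carriers there are  *)
(* chain maps in both directions that preserve these subcomplexes, any two of  *)
(* them are chain homotopic, and so the two cohomologies agree.                *)

From HB Require Import structures.
Require Import Defs.
From mathcomp Require Import all_boot all_order all_algebra.
From mathcomp Require Import zify ring.
From mathcomp Require Import reals.

Set Implicit Arguments.
Unset Strict Implicit.
Unset Printing Implicit Defensive.

Import GRing.Theory.
Local Open Scope ring_scope.

(** * Chains and acyclic carriers *)

(** The comparison takes place on chains. A [cell_complex] is a chain complex with a finite basis of
    cells, and a [model] presents a cochain complex as its dual: [form_model] does so for the forms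
    of a graph, with simplices as cells, and [tens_model] for a tensor product, with pairs of cells.
    The de Rham complex is thus dual to the products of simplices of G and H, while the forms on G x
    H are dual to the chains of the poset of these products, that is, to their barycentric
    subdivision.

    No subdivision map is written down. Instead each cell has a carrier, a pair (x, y): a product
    cell carries itself, and a chain of pairs is carried by its largest member. In both complexes
    the cells carried below a given pair have an explicit contraction ([tens_carried] applied to
    [face_carried], and [product_carried]). A contraction fills cycles inside their carrier
    ([cone_fill]), so carrier-preserving chain maps exist ([carried_lift]) and any two of them are
    homotopic ([carried_homotopy]), by induction on the dimension. This gives maps in both
    directions whose composites are homotopic to the identity. [carried_cohomology_iso] transposes
    maps and homotopies to cochains. *)

Notation chain K T := {ffun T -> K^o}.

Section Chains.
Variable K : fieldType.
Implicit Types T : finType.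

Definition delta T (t : T) : chain K T := [ffun u => (u == t)%:R].

(** Linear extension from the basis [delta]; boundaries, chain maps, homotopies and evaluations of
    cochains on chains all take this form. *)
Definition ext T (V : lmodType K) (F : T -> V) (c : chain K T) : V :=
  \sum_t (c t : K) *: F t.

Definition supported T (A : pred T) (c : chain K T) := forall t, c t != 0 -> A t.

Fact ext_is_linear T (V : lmodType K) (F : T -> V) : linear (ext F).
Proof.
move=> a c c'; rewrite /ext scaler_sumr -big_split; apply: eq_bigr => t _ /=.
by rewrite !ffunE scalerDl scalerA.
Qed.
HB.instance Definition _ T (V : lmodType K) (F : T -> V) :=
  GRing.isLinear.Build K (chain K T) V _ (ext F) (ext_is_linear F).

Lemma ext_delta T (V : lmodType K) (F : T -> V) t : ext F (delta t) = F t.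
Proof.
rewrite /ext (bigD1 t) //= ffunE eqxx scale1r big1 ?addr0 // => u /negPf ut.
by rewrite ffunE ut scale0r.
Qed.

Lemma ext_comp T (V W : lmodType K) (L : {linear V -> W}) (F : T -> V) c :
  L (ext F c) = ext (fun t => L (F t)) c.
Proof. by rewrite linear_sum; apply: eq_bigr => t _; rewrite linearZ. Qed.

Lemma eq_ext T (V : lmodType K) (A : pred T) (F F' : T -> V) c :
  supported A c -> (forall t, A t -> F t = F' t) -> ext F c = ext F' c.
Proof.
move=> cA FF'; apply: eq_bigr => t _; have [->|/cA/FF' -> //] := eqVneq (c t) 0.
by rewrite !scale0r.
Qed.

Lemma ext_eq0 T (V : lmodType K) (A : pred T) (F : T -> V) c :
  supported A c -> (forall t, A t -> F t = 0) -> ext F c = 0.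
Proof.
move=> cA F0; rewrite (eq_ext cA F0) /ext big1 // => t _; exact: scaler0.
Qed.

Lemma ext_id T (c : chain K T) : ext (@delta T) c = c.
Proof.
apply/ffunP=> u; rewrite sum_ffunE (bigD1 u) //= !ffunE eqxx [_ *: _]mulr1.
rewrite big1 ?addr0 // => t tu.
by rewrite !ffunE eq_sym (negPf tu) scaler0.
Qed.

Lemma extD T (V : lmodType K) (F F' : T -> V) c :
  ext (fun t => F t + F' t) c = ext F c + ext F' c.
Proof. by rewrite /ext -big_split; apply: eq_bigr => t _; rewrite scalerDr. Qed.

Lemma extN T (V : lmodType K) (F : T -> V) c :
  ext (fun t => - F t) c = - ext F c.
Proof. by rewrite /ext -sumrN; apply: eq_bigr => t _; rewrite scalerN. Qed.

Lemma extZ T (V : lmodType K) (F : T -> V) a c :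
  ext (fun t => a *: F t) c = a *: ext F c.
Proof. by rewrite /ext scaler_sumr; apply: eq_bigr => t _; rewrite scalerA mulrC -scalerA. Qed.

Definition aug T : chain K T -> K^o := ext (fun=> 1).
HB.instance Definition _ T := GRing.Linear.on (@aug T).

Lemma ext_const T (V : lmodType K) (v : V) c :
  ext (fun _ : T => v) c = (aug c : K) *: v.
Proof.
rewrite /aug /ext scaler_suml; apply: eq_bigr => t _.
by congr (_ *: _); rewrite [RHS]mulr1.
Qed.

Lemma aug_delta T (t : T) : aug (delta t) = 1.
Proof. exact: ext_delta. Qed.

Lemma aug_ext T T' (F : T -> chain K T') c :
  aug (ext F c) = ext (fun t => aug (F t)) c.
Proof. exact: ext_comp. Qed.

Lemma supported0 T (A : pred T) : supported A (0 : chain K T).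
Proof. by move=> t; rewrite ffunE eqxx. Qed.

Lemma supportedD T (A : pred T) c c' :
  supported A c -> supported A c' -> supported A (c + c').
Proof.
move=> cA c'A t; rewrite ffunE; have [->|/cA //] := eqVneq (c t) 0.
by rewrite add0r => /c'A.
Qed.

Lemma supportedZ T (A : pred T) a c : supported A c -> supported A (a *: c).
Proof. by move=> cA t; rewrite ffunE mulf_eq0 negb_or => /andP[_ /cA]. Qed.

Lemma supportedN T (A : pred T) c : supported A c -> supported A (- c).
Proof. by move=> cA t; rewrite ffunE oppr_eq0 => /cA. Qed.

Lemma supported_delta T (A : pred T) t : A t -> supported A (delta t).
Proof. by move=> At u; rewrite ffunE; case: (eqVneq u t) => [->|_]; rewrite ?eqxx. Qed.

Lemma supported_sum T (A : pred T) (I : Type) (r : seq I) (Q : pred I)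
    (F : I -> chain K T) :
  (forall i, Q i -> supported A (F i)) -> supported A (\sum_(i <- r | Q i) F i).
Proof.
move=> FA; elim/big_ind: _ => //; first exact: supported0.
exact: supportedD.
Qed.

Lemma supported_ext T T' (A : pred T) (B : pred T') (F : T -> chain K T') c :
  supported A c -> (forall t, A t -> supported B (F t)) -> supported B (ext F c).
Proof.
move=> cA FB; apply: supported_sum => t _.
have [->|/cA/FB] := eqVneq (c t) 0; last exact: supportedZ.
by rewrite scale0r; apply: supported0.
Qed.

Lemma sub_supported T (A B : pred T) (c : chain K T) :
  (forall t, A t -> B t) -> supported A c -> supported B c.
Proof. by move=> AB cA t /cA/AB. Qed.

Lemma supported_pred0 T (A : pred T) (c : chain K T) :
  (forall t, ~~ A t) -> supported A c -> c = 0.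
Proof.
move=> A0 cA; apply/ffunP=> t; rewrite ffunE; apply/eqP/negPn/negP => /cA.
exact/negP.
Qed.

Record cell_complex := CellComplex {
  cell :> finType;
  cdim : cell -> nat;
  bd : cell -> chain K cell;
  bd_dim : forall t, supported (fun u => cdim t == (cdim u).+1) (bd t);
  bdK : forall t, ext bd (bd t) = 0
}.

Lemma bd_dim0 (X : cell_complex) (t : X) : cdim t = 0 -> bd t = 0.
Proof. by move=> t0; apply: supported_pred0 (@bd_dim X t) => u; rewrite t0. Qed.

(** Recursion on the dimension: the value at a cell may use the values already given to its
    boundary. *)
Lemma dim_rec (X : cell_complex) (V : lmodType K) (F : X -> V -> V) :
  exists f : X -> V, forall t, f t = F t (ext f (bd t)).
Proof.
(* The fuel is the dimension. At fuel 0 the argument 0 is the right one, since a cell of dimension 0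
   has no boundary. *)
pose fix g n t {struct n} := if n is m.+1 then F t (ext (g m) (bd t)) else F t 0.
exists (fun t => g (cdim t) t) => t.
case t_n: (cdim t) => [|n] /=; first by rewrite bd_dim0 ?linear0.
congr (F t _); apply: eq_ext (@bd_dim X t) _ => u.
by rewrite t_n eqSS => /eqP<-.
Qed.

(* The chains carried by p form a subcomplex which cone p contracts to pt p.  *)
Record carried (X : cell_complex) (P : Type) (le : rel P) := Carried {
  carrier : X -> P;
  cone : P -> X -> chain K X;
  pt : P -> chain K X;
  carrier_bd : forall t, supported (fun u => le (carrier u) (carrier t)) (bd t);
  aug_bd : forall t : X, cdim t = 1 -> aug (bd t) = 0;
  pt_carrier : forall p,
    supported (fun u => (cdim u == 0) && le (carrier u) p) (pt p);
  aug_pt : forall p, aug (pt p) = 1;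
  cone_carrier : forall p (t : X), le (carrier t) p ->
    supported (fun u => (cdim u == (cdim t).+1) && le (carrier u) p) (cone p t);
  cone_bd : forall p (t : X), le (carrier t) p ->
    ext (@bd X) (cone p t) + ext (cone p) (bd t)
      = delta t - (cdim t == 0)%:R *: pt p
}.

(** * The method of acyclic carriers *)

Section AcyclicCarriers.
Variables (P : Type) (le : rel P).
Hypotheses (le_refl : reflexive le) (le_trans : transitive le).

Definition below (X : cell_complex) (cX : carried X le) p n : pred X :=
  fun t => (cdim t == n) && le (carrier cX t) p.

Section Fill.
Variables (X : cell_complex) (cX : carried X le).

Lemma below_trans p q n c :
  le p q -> supported (below cX p n) c -> supported (below cX q n) c.
Proof.
by move=> pq; apply: sub_supported => t /andP[tn tp]; rewrite /below tn (le_trans tp).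
Qed.

Lemma bd_below t n : cdim t = n.+1 -> supported (below cX (carrier cX t) n) (bd t).
Proof.
move=> tn u u0; rewrite /below (carrier_bd cX u0) andbT.
by have := bd_dim u0; rewrite tn eqSS eq_sym.
Qed.

Lemma cone_supported p n c :
  supported (below cX p n) c -> supported (below cX p n.+1) (ext (cone cX p) c).
Proof.
by move=> cp; apply: supported_ext cp _ => t /andP[/eqP<- tp]; apply: cone_carrier.
Qed.

(** In the identity dh + hd = 1 - pi of the contraction, hd vanishes on a cycle. So does pi: for
    positive [n] by dimension, and for [n = 0] because pi multiplies the point by the
    augmentation. *)
Lemma cone_fill p n c :
    supported (below cX p n) c -> ext (@bd X) c = 0 -> (n = 0 -> aug c = 0) ->
  ext (@bd X) (ext (cone cX p) c) = c.
Proof.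
move=> cp dc0 ec0; have /eqP := congr1 (ext (cone cX p)) dc0.
rewrite linear0 ext_comp /= => /eqP h0; rewrite ext_comp.
rewrite -[LHS]addr0 -h0 -extD.
rewrite (eq_ext (F' := fun t => delta t - (n == 0)%:R *: pt cX p) cp); last first.
  by move=> t /andP[/eqP<- tp]; apply: cone_bd.
rewrite extD extN ext_id extZ ext_const; case: eqVneq => [/ec0->|_].
  by rewrite scale0r scaler0 subr0.
by rewrite scale0r subr0.
Qed.

End Fill.

Section Lift.
Variables (X Y : cell_complex) (cX : carried X le) (cY : carried Y le).

Definition carried_map (f : X -> chain K Y) := forall t,
  [/\ supported (below cY (carrier cX t) (cdim t)) (f t),
      ext (@bd Y) (f t) = ext f (bd t)
    & cdim t = 0 -> aug (f t) = 1].

(** Vertices go to the point of their carrier; a cell of higher dimension goes to the cone over the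
    image of its boundary, which is a cycle by induction and lies in the carrier of the cell because
    carriers of faces are smaller. *)
Lemma carried_lift : exists f, carried_map f.
Proof.
have [f fE] := @dim_rec X (chain K Y)
  (fun t c => if cdim t == 0 then pt cY (carrier cX t) else ext (cone cY (carrier cX t)) c).
exists f => t; have [n] := ubnP (cdim t); elim: n t => // n IHn t.
rewrite ltnS => t_n; rewrite fE; case t_m: (cdim t) => [|m] /=.
  split=> [||_]; [exact: pt_carrier | | exact: aug_pt].
  rewrite bd_dim0 // linear0; apply: ext_eq0 (@pt_carrier _ _ _ cY _) _ => u.
  by case/andP=> /eqP u0 _; apply: bd_dim0.
have {}IHn u : cdim u = m -> [/\ supported (below cY (carrier cX u) (cdim u)) (f u),
    ext (@bd Y) (f u) = ext f (bd u) & cdim u = 0 -> aug (f u) = 1].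
  by move=> um; apply: IHn; rewrite um -t_m.
have sup : supported (below cY (carrier cX t) m) (ext f (bd t)).
  apply: supported_ext (bd_below cX t_m) _ => u /andP[/eqP um up].
  by apply: below_trans up _; have [+ _ _] := IHn u um; rewrite um.
split=> //; first exact: cone_supported.
apply: cone_fill sup _ _.
  rewrite ext_comp /= (eq_ext (F' := fun u => ext f (bd u)) (bd_below cX t_m)).
    by rewrite -ext_comp bdK linear0.
  by move=> u /andP[/eqP um _]; have [_ -> _] := IHn u um.
(* For an edge, a filling also needs augmentation 0: [f] preserves augmentation on vertices, and the
   boundary of an edge has augmentation 0. *)
move=> m0.
rewrite aug_ext (eq_ext (F' := fun=> 1 : K^o) (bd_below cX t_m)).
  by rewrite -/(aug _) (aug_bd cX) // t_m m0.
by move=> u /andP[/eqP um _]; have [_ _ ->] := IHn u um; rewrite // um.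
Qed.

(** The homotopy at [t] must fill [f t - g t - s (bd t)], a cycle in the carrier of [t]; its cone
    does. *)
Lemma carried_homotopy f g : carried_map f -> carried_map g ->
  exists s : X -> chain K Y, forall t,
    supported (fun u => cdim u == (cdim t).+1) (s t)
    /\ ext (@bd Y) (s t) + ext s (bd t) = f t - g t.
Proof.
move=> fP gP.
have [s sE] := @dim_rec X (chain K Y)
  (fun t c => ext (cone cY (carrier cX t)) (f t - g t - c)).
suff sP t : supported (below cY (carrier cX t) (cdim t).+1) (s t)
    /\ ext (@bd Y) (s t) + ext s (bd t) = f t - g t.
  exists s => t; have [st seq] := sP t; split=> //.
  by apply: sub_supported st => u /andP[].
have [n] := ubnP (cdim t); elim: n t => // n IHn t; rewrite ltnS => t_n.
have [fs fd fa] := fP t; have [gs gd ga] := gP t.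
have IH u : (cdim u < cdim t)%N -> supported (below cY (carrier cX u) (cdim u).+1) (s u)
    /\ ext (@bd Y) (s u) + ext s (bd u) = f u - g u.
  by move=> ut; apply: IHn; apply: leq_trans t_n.
have lt_bd : supported (fun u => cdim u < cdim t)%N (bd t).
  by apply: sub_supported (@bd_dim X t) => u /eqP->.
have sup : supported (below cY (carrier cX t) (cdim t)) (f t - g t - ext s (bd t)).
  apply: supportedD; last apply: supportedN.
    by apply: supportedD => //; apply: supportedN.
  case t_m: (cdim t) => [|m]; first by rewrite bd_dim0 // linear0; apply: supported0.
  apply: supported_ext (bd_below cX t_m) _ => u /andP[/eqP um up].
  by apply: below_trans up _; have [|+ _] := IH u; rewrite um ?t_m.
rewrite sE; split; first exact: cone_supported.
rewrite (cone_fill sup) ?subrK //; last first.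
  move=> t0; rewrite bd_dim0 // linear0 subr0.
  by rewrite linearB /= fa ?ga ?subrr.
(* The chain to fill is a cycle: by induction the boundary of [s (bd t)] is
   [(f - g) (bd t) - s (bd (bd t))], whose last term is 0. *)
rewrite !linearB /= fd gd [ext _ (ext s _)]ext_comp /=.
rewrite (eq_ext (F := fun u => ext (@bd Y) (s u))
  (F' := fun u => f u - g u - ext s (bd u)) lt_bd).
  by rewrite !extD !extN -[ext (fun u => ext s _) _]ext_comp /= bdK linear0 subr0 subrr.
by move=> u /IH[_ <-]; rewrite addrK.
Qed.

End Lift.

Lemma carried_id (X : cell_complex) (cX : carried X le) :
  carried_map cX cX (@delta X).
Proof.
move=> t; split=> [||_].
- by apply: supported_delta; rewrite /below eqxx le_refl.
- by rewrite ext_delta ext_id.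
exact: aug_delta.
Qed.

Lemma carried_comp (X Y Z : cell_complex) (cX : carried X le) (cY : carried Y le)
    (cZ : carried Z le) f g :
  carried_map cX cY f -> carried_map cY cZ g ->
  carried_map cX cZ (fun t => ext g (f t)).
Proof.
move=> fP gP t; have [fs fd fa] := fP t; split.
- apply: supported_ext fs _ => u /andP[/eqP<- ut].
  by apply: below_trans ut _; have [] := gP u.
- rewrite ext_comp -[RHS]ext_comp -fd [RHS]ext_comp /=.
  by apply: (@eq_ext _ _ xpredT) => // u _; have [] := gP u.
move=> t0; rewrite aug_ext (eq_ext (F' := fun=> 1 : K^o) fs).
  by rewrite -/(aug _) fa.
by move=> u /andP[/eqP ut _]; have [_ _ ->] := gP u; rewrite // ut.
Qed.

End AcyclicCarriers.
End Chains.

(** * Tensor products *)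

Section Box.
Variables (K : fieldType) (S T : finType).

Definition box (c : chain K S) (d : chain K T) : chain K (S * T)%type :=
  [ffun p => (c p.1 : K) * d p.2].

Fact box_is_linear c : linear (box c).
Proof. by move=> a d d'; apply/ffunP=> p; rewrite !ffunE mulrDr mulrCA. Qed.
HB.instance Definition _ c :=
  GRing.isLinear.Build K (chain K T) (chain K (S * T)%type) _ (box c) (box_is_linear c).

Lemma box0l d : box 0 d = 0.
Proof. by apply/ffunP=> p; rewrite !ffunE mul0r. Qed.
Lemma boxDl c c' d : box (c + c') d = box c d + box c' d.
Proof. by apply/ffunP=> p; rewrite !ffunE mulrDl. Qed.
Lemma boxNl c d : box (- c) d = - box c d.
Proof. by apply/ffunP=> p; rewrite !ffunE mulNr. Qed.
Lemma boxZl a c d : box (a *: c) d = a *: box c d.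
Proof. by apply/ffunP=> p; rewrite !ffunE -mulrA. Qed.

Lemma ext_box (V : lmodType K) (F : S * T -> V) c d :
  ext F (box c d) = ext (fun s => ext (fun t => F (s, t)) d) c.
Proof.
rewrite /ext; under [RHS]eq_bigr do rewrite scaler_sumr.
rewrite pair_bigA; apply: eq_bigr => -[s t] _.
by rewrite ffunE scalerA.
Qed.

Lemma box_delta s t : box (delta K s) (delta K t) = delta K (s, t).
Proof. by apply/ffunP=> p; rewrite !ffunE -natrM mulnb. Qed.

Lemma ext_boxr (U : finType) c (F : U -> chain K T) d :
  ext (fun u => box c (F u)) d = box c (ext F d).
Proof. by rewrite [RHS]ext_comp. Qed.

Lemma ext_boxl (U : finType) (F : U -> chain K S) c d :
  ext (fun u => box (F u) d) c = box (ext F c) d.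
Proof.
apply/ffunP=> p; rewrite !ffunE !sum_ffunE mulr_suml; apply: eq_bigr => u _.
by rewrite !ffunE -mulrA.
Qed.

Lemma supported_box (A : pred S) (B : pred T) c d :
  supported A c -> supported B d ->
  supported (fun p => A p.1 && B p.2) (box c d).
Proof.
by move=> cA dB p; rewrite ffunE mulf_eq0 negb_or => /andP[/cA-> /dB->].
Qed.

Lemma aug_box c d : aug (box c d) = (aug c : K) * aug d.
Proof. by rewrite {1}/aug ext_box -/(aug d) ext_const. Qed.

End Box.

Section TensorCells.
Variables (K : fieldType) (X Y : cell_complex K).

(** The grading involution. It carries the Koszul sign of the Leibniz rule, so that the rule can be
    stated for chains of mixed dimension. *)
Let sgc (c : chain K X) := ext (fun s => (-1) ^+ cdim s *: delta K s) c.

Definition tens_dim (p : X * Y) := (cdim p.1 + cdim p.2)%N.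
Definition tens_bd (p : X * Y) : chain K (X * Y)%type :=
  box (bd p.1) (delta K p.2) + (-1) ^+ cdim p.1 *: box (delta K p.1) (bd p.2).

Fact tens_bd_dim p : supported (fun q => tens_dim p == (tens_dim q).+1) (tens_bd p).
Proof.
apply: supportedD; last apply: supportedZ.
  apply: sub_supported (supported_box (@bd_dim _ _ _)
    (@supported_delta _ _ (pred1 p.2) _ (eqxx _))) => q /andP[/eqP q1 /eqP q2].
  by rewrite /tens_dim q1 q2.
apply: sub_supported (supported_box (@supported_delta _ _ (pred1 p.1) _ (eqxx _))
  (@bd_dim _ _ _)) => q /andP[/eqP q1 /eqP q2].
by rewrite /tens_dim q1 q2 addnS.
Qed.

Lemma sgc_bd s : sgc (bd s) = - (-1) ^+ cdim s *: bd s.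
Proof.
rewrite /sgc (eq_ext (F' := fun u => - (-1) ^+ cdim s *: delta K u) (@bd_dim _ _ s)).
  by rewrite extZ ext_id.
by move=> u /eqP->; rewrite exprS mulN1r opprK.
Qed.

Lemma ext_tens_bd c d :
  ext tens_bd (box c d) = box (ext (@bd _ X) c) d + box (sgc c) (ext (@bd _ Y) d).
Proof.
rewrite ext_box -!ext_boxl -extD; apply: eq_bigr => s _; congr (_ *: _).
by rewrite /tens_bd /= extD extZ !ext_boxr ext_id boxZl.
Qed.

Fact tens_bdK p : ext tens_bd (tens_bd p) = 0.
Proof.
rewrite linearD linearZ /= !ext_tens_bd !ext_delta !bdK box0l add0r linear0 addr0.
by rewrite sgc_bd boxZl scaleNr addNr.
Qed.

Definition tens_cells := CellComplex tens_bd_dim tens_bdK.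

Variables (P Q : Type) (leP : rel P) (leQ : rel Q).
Hypotheses (leP_refl : reflexive leP) (leQ_refl : reflexive leQ).
Variables (cX : carried X leP) (cY : carried Y leQ).

Definition prod_le : rel (P * Q) := fun p q => leP p.1 q.1 && leQ p.2 q.2.

(** The chain endomorphism that contracts everything to the point: it is the augmentation in
    dimension 0 followed by the inclusion of [pt]. *)
Let ptX p (s : X) : chain K X := (cdim s == 0)%:R *: pt cX p.

Definition tens_carrier (t : tens_cells) := (carrier cX t.1, carrier cY t.2).
Definition tens_pt p : chain K tens_cells := box (pt cX p.1) (pt cY p.2).
(* The contraction h (x) 1 + pi (x) h', where pi projects onto the point.     *)
Definition tens_cone p (t : tens_cells) : chain K tens_cells :=
  box (cone cX p.1 t.1) (delta K t.2) + box (ptX p.1 t.1) (cone cY p.2 t.2).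

Fact tens_carrier_bd t :
  supported (fun u => prod_le (tens_carrier u) (tens_carrier t)) (bd t).
Proof.
apply: supportedD; last apply: supportedZ.
  apply: sub_supported (supported_box (@carrier_bd _ _ _ _ cX _)
    (@supported_delta _ _ (pred1 t.2) _ (eqxx _))) => u /andP[ut /eqP u2].
  by rewrite /prod_le /= ut u2 leQ_refl.
apply: sub_supported (supported_box (@supported_delta _ _ (pred1 t.1) _ (eqxx _))
  (@carrier_bd _ _ _ _ cY _)) => u /andP[/eqP u1 ut].
by rewrite /prod_le /= ut u1 leP_refl.
Qed.

Fact tens_aug_bd (t : tens_cells) : cdim t = 1 -> aug (bd t) = 0.
Proof.
have aug0 (Z : cell_complex K) (W : Type) (le : rel W) (cZ : carried Z le) (z : Z) :
    (cdim z <= 1)%N -> aug (bd z) = 0.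
  rewrite leq_eqVlt ltnS leqn0 => /orP[/eqP/(aug_bd cZ) //|/eqP z0].
  by rewrite bd_dim0 ?linear0.
move=> t1; have t12 : (cdim t.1 + cdim t.2 = 1)%N by [].
rewrite linearD linearZ /= !aug_box (aug0 _ _ _ cX) ?(aug0 _ _ _ cY); try lia.
by rewrite mul0r mulr0 scaler0 addr0.
Qed.

Fact tens_pt_carrier p :
  supported (fun u => (cdim u == 0) && prod_le (tens_carrier u) p) (tens_pt p).
Proof.
apply: sub_supported (supported_box (@pt_carrier _ _ _ _ cX _) (@pt_carrier _ _ _ _ cY _)).
move=> u /andP[/andP[/eqP u1 p1] /andP[/eqP u2 p2]].
by rewrite /prod_le /= /tens_dim u1 u2 p1 p2.
Qed.

Fact tens_aug_pt p : aug (tens_pt p) = 1.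
Proof. by rewrite aug_box !aug_pt mulr1. Qed.

Fact tens_cone_carrier p (t : tens_cells) : prod_le (tens_carrier t) p ->
  supported (fun u => (cdim u == (cdim t).+1) && prod_le (tens_carrier u) p)
    (tens_cone p t).
Proof.
case/andP=> /= tp1 tp2; apply: supportedD.
  apply: sub_supported (supported_box (@cone_carrier _ _ _ _ cX _ _ tp1)
    (@supported_delta _ _ (pred1 t.2) _ (eqxx _))) => u.
  move=> /andP[/andP[/eqP u1 up] /eqP u2].
  by rewrite /prod_le /= /tens_dim u1 u2 up tp2 addSn eqxx.
rewrite /ptX; case: eqVneq => [t0|_]; last first.
  by rewrite scale0r box0l; apply: supported0.
rewrite boxZl; apply: supportedZ.
apply: sub_supported (supported_box (@pt_carrier _ _ _ _ cX _)
  (@cone_carrier _ _ _ _ cY _ _ tp2)) => u.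
move=> /andP[/andP[/eqP u1 up1] /andP[/eqP u2 up2]].
by rewrite /prod_le /= /tens_dim u1 u2 up1 up2 t0 eqxx.
Qed.

(** Only the boundary of an edge contains vertices, and it has augmentation 0. *)
Lemma ext_ptX_bd p s : ext (ptX p) (bd s) = 0.
Proof.
have [s1|s1] := eqVneq (cdim s) 1%N.
  rewrite (eq_ext (F' := fun=> pt cX p) (@bd_dim _ X s)).
    by rewrite ext_const (aug_bd cX) // scale0r.
  by move=> u; rewrite s1 eqSS eq_sym /ptX => ->; rewrite scale1r.
apply: ext_eq0 (@bd_dim _ X s) _ => u /eqP su; rewrite /ptX.
have /negPf->: cdim u != 0 by apply: contra s1; rewrite su eqSS.
by rewrite scale0r.
Qed.

Lemma ptX_bd p s : ext (@bd _ X) (ptX p s) = 0.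
Proof.
rewrite linearZ /= (ext_eq0 (@pt_carrier _ _ _ _ cX p)) ?scaler0 //.
by move=> u /andP[/eqP u0 _]; apply: bd_dim0.
Qed.

Lemma sgc_ptX p s : sgc (ptX p s) = ptX p s.
Proof.
rewrite /sgc linearZ /=; congr (_ *: _); rewrite -[RHS]ext_id.
apply: eq_ext (@pt_carrier _ _ _ _ cX p) _.
by move=> u /andP[/eqP-> _]; rewrite scale1r.
Qed.

Lemma sgc_cone p s : leP (carrier cX s) p ->
  sgc (cone cX p s) = - (-1) ^+ cdim s *: cone cX p s.
Proof.
move=> sp; rewrite /sgc.
rewrite (eq_ext (F' := fun u => - (-1) ^+ cdim s *: delta K u)
  (@cone_carrier _ _ _ _ cX _ _ sp)); first by rewrite extZ ext_id.
by move=> u /andP[/eqP-> _]; rewrite exprS mulN1r.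
Qed.

Lemma ext_tens_cone p c d : ext (tens_cone p) (box c d) =
  box (ext (cone cX p.1) c) d + box (ext (ptX p.1) c) (ext (cone cY p.2) d).
Proof.
rewrite ext_box -!ext_boxl -extD; apply: eq_bigr => s _; congr (_ *: _).
by rewrite /tens_cone /= extD !ext_boxr ext_id.
Qed.

(** With dh + hd = 1 - pi in each factor, h (x) 1 contributes 1 (x) 1 - pi (x) 1 and pi (x) h'
    contributes pi (x) 1 - pi (x) pi'; the mixed terms cancel by the sign of h. *)
Fact tens_cone_bd p (t : tens_cells) : prod_le (tens_carrier t) p ->
  ext (@bd _ tens_cells) (tens_cone p t) + ext (tens_cone p) (bd t)
    = delta K t - (cdim t == 0)%:R *: tens_pt p.
Proof.
case: t => s t; case/andP=> /= sp tp.
rewrite /tens_cone /tens_bd /= !linearD /= !linearZ /= !ext_tens_bd !ext_tens_cone.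
rewrite !ext_delta ext_ptX_bd ptX_bd !box0l add0r addr0 sgc_ptX sgc_cone // boxZl.
rewrite [ptX _ _]/(_ *: _) !boxZl -box_delta scalerN.
have -> : ext (@bd _ X) (cone cX p.1 s)
    = delta K s - (cdim s == 0)%:R *: pt cX p.1 - ext (cone cX p.1) (bd s).
  by rewrite -(cone_bd sp) addrK.
have -> : ext (@bd _ Y) (cone cY p.2 t)
    = delta K t - (cdim t == 0)%:R *: pt cY p.2 - ext (cone cY p.2) (bd t).
  by rewrite -(cone_bd tp) addrK.
rewrite !(boxDl, boxNl, boxZl, linearD, linearN) !linearZ /=.
rewrite /tens_dim /= addn_eq0 -/(tens_pt p) -mulnb natrM.
(* The projection pi is nonzero only in dimension 0, where the sign is 1. *)
have -> : (cdim s == 0)%:R *: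
    ((-1) ^+ cdim s *: box (pt cX p.1) (ext (cone cY p.2) (bd t)))
    = ((cdim s == 0)%:R : K) *: box (pt cX p.1) (ext (cone cY p.2) (bd t)).
  by case: eqVneq => [->|_]; rewrite ?scale1r // !scale0r.
apply/ffunP=> u; rewrite !ffunE; do ?rewrite -[_ *: _]/(_ * _).
move: ((cdim s == 0)%:R : K) ((cdim t == 0)%:R : K) ((-1) ^+ cdim s : K) => *.
ring.
Qed.

Definition tens_carried : carried tens_cells prod_le :=
  Carried tens_carrier_bd tens_aug_bd tens_pt_carrier tens_aug_pt
    tens_cone_carrier tens_cone_bd.

End TensorCells.

(** * Simplicial chains *)

Definition simplices (G : sgraph) := {A : {set G} | simplex A}.

Section SimplexLemmas.
Variable G : sgraph.
Implicit Types A B : {set G}.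

Lemma simplex_adj A u v : simplex A -> u \in A -> v \in A -> u != v -> adj u v.
Proof. by case/andP=> _ /forall_inP Aadj /Aadj/forall_inP/[apply]/implyP. Qed.

Lemma simplexP A : A != set0 ->
  (forall u v, u \in A -> v \in A -> u != v -> adj u v) -> simplex A.
Proof.
move=> A0 Aadj; rewrite /simplex A0; apply/forall_inP=> u uA; apply/forall_inP=> v vA.
by apply/implyP; apply: Aadj.
Qed.

Lemma sub_simplex A B : simplex A -> B \subset A -> B != set0 -> simplex B.
Proof.
move=> sA /subsetP BA B0; apply: simplexP => // u v /BA uA /BA vA.
exact: simplex_adj sA uA vA.
Qed.

Lemma simplex1 (v : G) : simplex [set v].
Proof.
apply: simplexP => [|u w]; first by apply/set0Pn; exists v; rewrite set11.
by rewrite !inE => /eqP-> /eqP->; rewrite eqxx.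
Qed.

Lemma card_simplex_gt0 A : simplex A -> (0 < #|A|)%N.
Proof. by rewrite card_gt0 => /andP[]. Qed.

End SimplexLemmas.

Section SimplexCells.
Variables (K : fieldType) (G : sgraph) (rho : G -> nat).
Hypothesis rho_inj : injective rho.
Implicit Types (A B : {set G}) (a b : simplices G) (u v w : G).

(** The index, from 0, of [u] in the list of [A] sorted by [rho]; this order of the vertices orients
    every simplex. *)
Definition pos u A := #|[set w in A | (rho w < rho u)%N]|.

(* The generator of a simplex; in particular set0 generates nothing. *)
Definition sdelta A : chain K (simplices G) := oapp (@delta K _) 0 (insub A).

Definition sbd A := \sum_(u in A) (-1) ^+ pos u A *: sdelta (A :\ u).

Lemma sdelta_val a : sdelta (val a) = delta K a.
Proof. by rewrite /sdelta valK. Qed.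

Lemma sdelta0 : sdelta set0 = 0.
Proof. by rewrite /sdelta insubN // /simplex eqxx. Qed.

Lemma sdeltaP (V : lmodType K) (F : simplices G -> V) A :
  ext F (sdelta A) = oapp F 0 (insub A).
Proof. by rewrite /sdelta; case: insub => [a|] /=; rewrite ?ext_delta ?linear0. Qed.

Lemma ext_sdelta (V : lmodType K) (F : {set G} -> V) A :
  simplex A -> ext (fun a => F (val a)) (sdelta A) = F A.
Proof. by move=> sA; rewrite sdeltaP insubT. Qed.

Lemma supported_sdelta (P : pred (simplices G)) A :
  (forall a, val a = A -> P a) -> supported P (sdelta A).
Proof.
rewrite /sdelta => PA; case: insubP => [a _ aA|_]; last exact: supported0.
exact/supported_delta/PA.
Qed.

Lemma aug_sdelta A : simplex A -> aug (sdelta A) = 1.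
Proof. exact: ext_sdelta (fun _ => 1 : K^o) A. Qed.

Lemma posD1 u w A : u \in A -> pos w A = ((rho u < rho w) + pos w (A :\ u))%N.
Proof.
move=> uA; rewrite /pos (cardsD1 u) inE uA /=; congr (_ + _)%N.
by congr #|pred_of_set _|; apply/setP=> x; rewrite !inE andbA.
Qed.

Lemma pos_setU1 u w A : u \notin A -> pos w (u |: A) = ((rho u < rho w) + pos w A)%N.
Proof. by move=> uA; rewrite (@posD1 u) ?setU11 // setU1K. Qed.

Lemma pos_min v A : (forall u, u \in A -> u != v -> rho v < rho u)%N -> pos v A = 0.
Proof.
move=> vA; apply/eqP; rewrite cards_eq0; apply/eqP/setP=> u; rewrite !inE.
by apply/negbTE/negP=> /andP[/vA]; case: eqVneq => [->|_ /(_ isT)] *; lia.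
Qed.

Lemma sbd0 : sbd set0 = 0.
Proof. by rewrite /sbd big1 // => u; rewrite inE. Qed.

Lemma sbd_dim a : supported (fun b => #|val a|.-1 == (#|val b|.-1).+1) (sbd (val a)).
Proof.
apply: supported_sum => u ua; apply/supportedZ/supported_sdelta => b bE.
by rewrite (cardsD1 u (val a)) ua -bE add1n prednK // card_simplex_gt0 // (valP b).
Qed.

Lemma ext_sbd A : simplex A -> ext (fun a => sbd (val a)) (sbd A) =
  \sum_(u in A) (-1) ^+ pos u A *: sbd (A :\ u).
Proof.
move=> sA; rewrite linear_sum; apply: eq_bigr => u uA; rewrite linearZ /=.
congr (_ *: _); have [->|u0] := eqVneq (A :\ u) set0.
  by rewrite sdelta0 sbd0 linear0.
by rewrite ext_sdelta // (sub_simplex sA) // subD1set.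
Qed.

(** A face of codimension 2 arises by removing two vertices in either order, with opposite signs. *)
Lemma sbdK a : ext (fun b => sbd (val b)) (sbd (val a)) = 0.
Proof.
rewrite ext_sbd ?(valP a) //; set A := val a.
pose F u w := (-1) ^+ pos u A *: ((-1) ^+ pos w (A :\ u) *: sdelta (A :\ u :\ w)).
transitivity (\sum_(p | [&& p.1 \in A, p.2 \in A & p.2 != p.1]) F p.1 p.2).
  under eq_bigr do rewrite scaler_sumr.
  rewrite pair_big_dep; apply: eq_bigl => -[u w] /=.
  by rewrite !inE andbC [_ && (w \in A)]andbC andbC.
rewrite (bigID (fun p => rho p.1 < rho p.2)%N) /=.
rewrite [X in _ + X](reindex_inj (can_inj (@swap_pairK _ _))) /=.
rewrite [X in _ + X](eq_big (fun p => [&& p.1 \in A, p.2 \in A & p.2 != p.1]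
  && (rho p.1 < rho p.2)%N) (fun p => - F p.1 p.2)) ?sumrN ?subrr //.
  move=> [u w] /=; rewrite andbCA -leqNgt ltn_neqAle (inj_eq rho_inj) eq_sym.
  by case: eqVneq; rewrite ?andbF.
move=> [u w] /=; rewrite -leqNgt => /andP[/and3P[wA uA uw] uw_le].
have {}uw_le : (rho u < rho w)%N by rewrite ltn_neqAle (inj_eq rho_inj) uw.
(* Removing the earlier vertex [u] first lowers the position of [w] by one, whereas removing [w]
   first does not move [u]. *)
rewrite /F setDDl setUC -setDDl !scalerA -scaleNr -!exprD; congr (_ *: _).
rewrite (posD1 w uA) uw_le (posD1 u wA) [(rho w < _)%N]ltnNge (ltnW uw_le) /=.
by rewrite add1n add0n addSn exprS mulN1r addnC.
Qed.

Definition simplex_cells :=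
  @CellComplex K (simplices G) (fun a => #|val a|.-1) (fun a => sbd (val a))
    sbd_dim sbdK.

(** No sign appears because the cone is only taken from a vertex that precedes the others. When [v]
    already lies in [A], the cone is degenerate. *)
Definition scone v A := if v \in A then 0 else sdelta (v |: A).

Lemma ext_scone v A B : simplex A -> B \subset A ->
  ext (fun a => scone v (val a)) (sdelta B) = if B == set0 then 0 else scone v B.
Proof.
move=> sA BA; case: eqVneq => [->|B0]; first by rewrite sdelta0 linear0.
by rewrite ext_sdelta // (sub_simplex sA).
Qed.

Lemma scone_bd v a :
    simplex (v |: val a) -> (forall u, u \in val a -> u != v -> rho v < rho u)%N ->
  ext (fun b => sbd (val b)) (scone v (val a))
    + ext (fun b => scone v (val b)) (sbd (val a))
  = delta K a - (#|val a|.-1 == 0)%:R *: sdelta [set v].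
Proof.
rewrite -sdelta_val; move: (val a) (valP a) => A sa sva va.
have A0 := card_simplex_gt0 sa.
have -> : ext (fun b => scone v (val b)) (sbd A) = \sum_(u in A) (-1) ^+ pos u A *:
    (if A :\ u == set0 then 0 else scone v (A :\ u)).
  rewrite linear_sum; apply: eq_bigr => u uA.
  by rewrite linearZ /= (ext_scone _ sa) ?subD1set.
(* If [v] is in [A], only the face opposite to [v] has a nonzero cone, namely [A]; for [A = [set v]]
   that face is empty and both sides are 0. *)
rewrite {1}/scone; case: (boolP (v \in A)) => vA.
  rewrite linear0 add0r (bigD1 v) //= big1 ?addr0; last first.
    move=> u /andP[uA uv]; rewrite /scone in_setD1 vA [v == u]eq_sym uv /=.
    by case: ifP; rewrite scaler0.
  rewrite pos_min // scale1r /scone setD11 setD1K //.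
  have -> : (#|A|.-1 == 0) = (A :\ v == set0).
    by rewrite -cards_eq0 (cardsD1 v A) vA.
  case: eqP => [Av|_]; last by rewrite scale0r subr0.
  have -> : A = [set v] by rewrite -(setD1K vA) Av setU0.
  by rewrite scale1r subrr.
(* Otherwise removing [v] from the cone returns [A], and removing [u] cancels the cone over
   [A :\ u], as [v] shifts the position of [u] by one. If [A] is a single vertex, the uncancelled
   face is [[set v]]. *)
rewrite ext_sdelta // {1}/sbd big_setU1 //= pos_min ?(setU1K vA) ?scale1r; last first.
  by move=> u; rewrite !inE => /orP[/eqP->|ua uv]; [rewrite eqxx | exact: va].
rewrite -addrA -big_split /=; congr (_ + _).
rewrite (eq_bigr (fun u => - ((A :\ u == set0)%:R * (-1) ^+ pos u A) *: sdelta [set v])).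
  rewrite -scaler_suml sumrN scaleNr; congr (- (_ *: _)).
  have [/cards1P[x ->]|A1] := boolP (#|A| == 1%N).
    rewrite cards1 big_set1 setDv eqxx mul1r pos_min //.
    by move=> u; rewrite !inE => ->.
  rewrite big1 => [|u uA]; first by case: #|A| A1 A0 => [|[|]].
  rewrite -cards_eq0; have := cardsD1 u A; rewrite uA.
  case: eqVneq => [->|_ _]; last by rewrite mul0r.
  by move=> A1'; rewrite A1' eqxx in A1.
move=> u uA; have uv : u != v by apply: contraNneq vA => <-.
rewrite pos_setU1 // va // add1n exprS mulN1r scaleNr.
have -> : (v |: A) :\ u = v |: A :\ u.
  by apply/setP=> x; rewrite !inE; case: eqVneq => //= ->; rewrite (negPf uv).
case: eqVneq => [->|_]; first by rewrite setU0 scaler0 addr0 mul1r scaleNr.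
by rewrite /scone !inE (negPf vA) andbF addNr mul0r oppr0 scale0r.
Qed.

Section Carried.
(** Conditions for the simplices carried by each [p] to be closed under coning from a vertex
    [apex p] that comes first in the orientation. *)
Variables (P : Type) (le : rel P) (carr : simplices G -> P) (apex : P -> G).
Hypothesis carr_mono : forall a b, val a \subset val b -> le (carr a) (carr b).
Hypothesis apex_carr : forall p a, val a = [set apex p] -> le (carr a) p.
Hypothesis cone_simplex : forall p a, le (carr a) p -> simplex (apex p |: val a).
Hypothesis cone_carr : forall p a b,
  le (carr a) p -> val b = apex p |: val a -> le (carr b) p.
Hypothesis apex_min : forall p a u,
  le (carr a) p -> u \in val a -> u != apex p -> (rho (apex p) < rho u)%N.

Fact simplex_carrier_bd (a : simplex_cells) :
  supported (fun b => le (carr b) (carr a)) (bd a).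
Proof.
apply: supported_sum => u ua; apply/supportedZ/supported_sdelta => b bE.
by apply: carr_mono; rewrite bE subD1set.
Qed.

Fact simplex_aug_bd (a : simplex_cells) : cdim a = 1 -> aug (bd a) = 0.
Proof.
move=> a1; have a2 : #|val a| = 2 by rewrite -(prednK (card_simplex_gt0 (valP a))) [_.-1]a1.
case/eqP/cards2P: a2 => x [y] [xy aE]; rewrite [bd a]/(sbd _).
wlog xy_lt : x y xy aE / (rho x < rho y)%N.
  move=> H; case: (ltngtP (rho x) (rho y)) => [/H|yx|/rho_inj/eqP]; first exact.
    by apply: (H y x); rewrite // 1?eq_sym // setUC.
  by rewrite (negPf xy).
have xV : x \notin [set y] by rewrite inE.
rewrite aE /sbd big_setU1 //= big_set1 !pos_setU1 // ltnn xy_lt !(@pos_min _ [set y]).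
- have -> : [set x; y] :\ x = [set y] by rewrite setU1K.
  have -> : [set x; y] :\ y = [set x] by rewrite setUC setU1K // inE eq_sym.
  rewrite linearD !linearZ /= !aug_sdelta ?simplex1 //.
  by rewrite -![_ *: _]/(_ * _) !mulr1 expr0 expr1 subrr.
- by move=> u; rewrite inE => /eqP->; rewrite eqxx.
by move=> u; rewrite inE => /eqP->.
Qed.

Fact simplex_pt_carrier p : supported
  (fun b : simplex_cells => (cdim b == 0) && le (carr b) p) (sdelta [set apex p]).
Proof.
apply: supported_sdelta => b bE; rewrite apex_carr // andbT.
by rewrite /= bE cards1.
Qed.

Fact simplex_aug_pt p : aug (sdelta [set apex p]) = 1.
Proof. exact/aug_sdelta/simplex1. Qed.

Fact simplex_cone_carrier p (a : simplex_cells) : le (carr a) p ->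
  supported (fun b : simplex_cells => (cdim b == (cdim a).+1) && le (carr b) p)
    (scone (apex p) (val a)).
Proof.
move=> ap; rewrite /scone; case: ifPn => pa; first exact: supported0.
apply: supported_sdelta => b bE; rewrite (cone_carr ap bE) andbT.
by rewrite /= bE cardsU1 pa add1n /= prednK // card_simplex_gt0 // (valP a).
Qed.

Fact simplex_cone_bd p (a : simplex_cells) : le (carr a) p ->
  ext (@bd _ simplex_cells) (scone (apex p) (val a))
    + ext (fun b : simplex_cells => scone (apex p) (val b)) (bd a)
  = delta K a - (cdim a == 0)%:R *: sdelta [set apex p].
Proof.
move=> ap; apply: scone_bd; first exact: cone_simplex.
by move=> u; apply: apex_min.
Qed.

Definition simplex_carried : carried simplex_cells le :=
  @Carried _ simplex_cells _ _ _ _ _ simplex_carrier_bd simplex_aug_bd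
    simplex_pt_carrier simplex_aug_pt simplex_cone_carrier simplex_cone_bd.

End Carried.

Lemma first_exists a : exists v, (v \in val a) && [forall u in val a, (rho v <= rho u)%N].
Proof.
have /card_gt0P[v va] := card_simplex_gt0 (valP a).
have [w wa wmin] := arg_minnP rho va.
by exists w; rewrite [w \in _]wa; apply/forall_inP.
Qed.

Definition first a : G := xchoose (first_exists a).

Lemma first_in a : first a \in val a.
Proof. by have /andP[] := xchooseP (first_exists a). Qed.

Lemma first_min a u : u \in val a -> u != first a -> (rho (first a) < rho u)%N.
Proof.
move=> ua uf; rewrite ltn_neqAle (inj_eq rho_inj) eq_sym uf.
by have /andP[_ /forall_inP] := xchooseP (first_exists a); apply.
Qed.

Definition face_le a b := val a \subset val b.

(** A face of [p] is coned from the first vertex of [p], and the result is again a face of [p]. *)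
Definition face_carried : carried simplex_cells face_le.
Proof.
apply: (@simplex_carried _ face_le (fun a => a) first) => //.
- by move=> p a aE; rewrite /face_le aE sub1set first_in.
- move=> p a /subsetP ap; apply: (sub_simplex (valP p)).
    by apply/subsetP=> u; rewrite !inE => /orP[/eqP->|/ap //]; apply: first_in.
  by apply/set0Pn; exists (first p); rewrite setU11.
- move=> p a b ap bE; rewrite /face_le bE subUset sub1set first_in; exact: ap.
by move=> p a u /subsetP ap /ap; apply: first_min.
Defined.

End SimplexCells.

(** * Cochain complexes dual to cell complexes *)

(* X indexes a basis of the dual of C: ev k t is the evaluation at t, which is *)
(* unconstrained unless cdim t = k.                                            *)
Record model (K : fieldType) (C : cochain_complex K) (X : cell_complex K) := Model {
  ev : forall k, X -> 'Hom(cobj C k, K^o);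
  ev_dual : forall k t, cdim t = k ->
    exists u, forall t', cdim t' = k -> ev k t' u = (t' == t)%:R;
  ev_inj : forall k u, (forall t, cdim t = k -> ev k t u = 0) -> u = 0;
  ev_diff : forall k t u, cdim t = k.+1 ->
    ev k.+1 t (cdiff C k u) = ext (ev k) (bd t) u
}.

Lemma ext_lfunE (K : fieldType) (T : finType) (U V : vectType K)
    (F : T -> 'Hom(U, V)) c u : ext F c u = ext (fun t => F t u) c.
Proof. by rewrite sum_lfunE; apply: eq_bigr => t _; rewrite scale_lfunE. Qed.

Section FormModel.
Variables (K : fieldType) (G : sgraph) (rho : G -> nat).
Hypothesis rho_inj : injective rho.
Implicit Types A B : {set G}.

Lemma pos_ltn u w A : u \in A -> (rho u < rho w)%N -> (pos rho u A < pos rho w A)%N.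
Proof.
move=> uA uw; apply/proper_card/properP; split.
  by apply/subsetP=> x; rewrite !inE => /andP[-> /ltn_trans->].
by exists u; rewrite !inE ?uA ?uw // ltnn andbF.
Qed.

Lemma pos_inj A : {in A &, injective (fun u => pos rho u A)}.
Proof.
move=> u w uA wA uw; apply: rho_inj; case: (ltngtP (rho u) (rho w)) => //.
  by move/(pos_ltn uA); rewrite uw ltnn.
by move/(pos_ltn wA); rewrite uw ltnn.
Qed.

Lemma pos_lt_card u A : u \in A -> (pos rho u A < #|A|)%N.
Proof.
move=> uA; apply/proper_card/properP; split.
  by apply/subsetP=> x; rewrite !inE => /andP[].
by exists u; rewrite // !inE ltnn andbF.
Qed.

(** The tuple [x] lists [A] in increasing order of [rho]. *)
Definition ordering k A (x : osimplex G k) :=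
  (underlying x == A) && [forall i, pos rho (val x i) A == i].

Lemma orderingP k A (x : osimplex G k) :
  reflect (underlying x = A /\ forall i, pos rho (val x i) A = i) (ordering A x).
Proof.
by apply: (iffP andP) => -[/eqP xA /'forall_eqP].
Qed.

Lemma mem_underlying k (x : osimplex G k) i : val x i \in underlying x.
Proof. exact: imset_f. Qed.

Lemma ordering_uniq k A (x y : osimplex G k) :
  ordering A x -> ordering A y -> x = y.
Proof.
move=> /orderingP[xA xpos] /orderingP[yA ypos]; apply/val_inj/ffunP=> i.
apply: (@pos_inj A); rewrite ?xpos ?ypos //.
  by rewrite -xA mem_underlying.
by rewrite -yA mem_underlying.
Qed.

(** The position map from [A] to the indices is injective, hence bijective by counting; its inverse
    is the listing. *)
Lemma ordering_exists k A : simplex A -> #|A| = k.+1 ->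
  exists x : osimplex G k, ordering A x.
Proof.
move=> sA cA; pose q u : 'I_k.+1 := inord (pos rho u A).
have qE u : u \in A -> q u = pos rho u A :> nat.
  by move=> uA; rewrite inordK // -cA pos_lt_card.
have q_inj : {in A &, injective q}.
  by move=> u w uA wA /(congr1 val) /=; rewrite !qE //; apply: pos_inj.
have qA : q @: A = [set: 'I_k.+1].
  by apply/eqP; rewrite eqEcard subsetT card_in_imset // cA cardsT card_ord leqnn.
have /fin_all_exists2[x xA xq] (i : 'I_k.+1) : exists2 u, u \in A & q u = i.
  have /imsetP[u uA ->] : i \in q @: A by rewrite qA in_setT.
  by exists u.
have x_inj : injective x by move=> i j xij; rewrite -(xq i) -(xq j) xij.
have x_im : [set [ffun i => x i] i | i : 'I_k.+1] = A.
  apply/eqP; rewrite eqEcard card_imset ?card_ord ?cA ?leqnn ?andbT; last first.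
    by move=> i j; rewrite !ffunE; apply: x_inj.
  by apply/subsetP=> _ /imsetP[i _ ->]; rewrite ffunE.
have xP : osimplex_pred [ffun i => x i].
  rewrite /osimplex_pred x_im sA andbT.
  by apply/injectiveP=> i j; rewrite !ffunE; apply: x_inj.
exists (Sub _ xP); apply/orderingP; split; first exact: x_im.
by move=> i; rewrite ffunE -qE // xq.
Qed.

Definition form_eval k (x : osimplex G k) (f : subvs_of (forms K G k)) : K^o := vsval f x.
Fact form_eval_linear k (x : osimplex G k) : linear (form_eval x).
Proof. by move=> a f g; rewrite /form_eval linearP !ffunE. Qed.
HB.instance Definition _ k x :=
  GRing.isLinear.Build K (subvs_of (forms K G k)) K^o _ _ (@form_eval_linear k x).

Local Notation X := (simplex_cells K rho_inj).

(** Evaluation at the increasing listing, with value 0 when the simplex has the wrong dimension and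
    no listing exists. *)
Definition form_ev k (a : X) : 'Hom(cobj (form_complex K G) k, K^o) :=
  if [pick x | ordering (val a) x] is Some x then linfun (@form_eval k x) else 0.

Lemma form_evE k (a : X) (x : osimplex G k) f : ordering (val a) x ->
  form_ev k a f = vsval f x.
Proof.
move=> ax; rewrite /form_ev; case: pickP => [y ay|/(_ x)]; last by rewrite ax.
by rewrite (ordering_uniq ay ax) lfunE.
Qed.

Lemma simplex_ordering k (a : X) : cdim a = k -> exists x : osimplex G k, ordering (val a) x.
Proof.
move=> ak; apply: ordering_exists; first exact: (valP a).
by rewrite -ak prednK // card_simplex_gt0 // (valP a).
Qed.

Fact form_ev_dual k (a : X) : cdim a = k ->
  exists f, forall b : X, cdim b = k -> form_ev k b f = (b == a)%:R.
Proof.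
move=> ak.
have /fin_all_exists[o oP] (A : ksimplex G k) : exists x : osimplex G k, ordering (val A) x.
  by have /andP[sA /eqP cA] := valP A; apply: ordering_exists.
(* The alternating form equal to 1 on the increasing listing of [a] and to 0 on those of the other
   simplices. *)
have [A|f [fE _]] := @form_orientation K G k o (fun A : ksimplex G k => (val A == val a)%:R).
  by have /orderingP[] := oP A.
exists f => b bk.
have bP : simplex (val b) && (#|val b| == k.+1).
  by rewrite (valP b) -bk prednK ?eqxx // card_simplex_gt0 // (valP b).
by rewrite (form_evE _ (oP (exist _ (val b) bP : ksimplex G k))) fE /= val_eqE.
Qed.

(** Every ordered simplex is a reordering of an increasing one, so alternation determines the
    form. *)
Fact form_ev_inj k f : (forall a : X, cdim a = k -> form_ev k a f = 0) -> f = 0.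
Proof.
move=> f0; apply/val_inj/ffunP=> x; rewrite linear0 ffunE.
have /andP[sx /eqP cx] := underlying_subproof x.
have [y xy] := ordering_exists sx cx.
have /orderingP[yx _] := xy.
have [s ->] := reorder_exists (esym yx).
rewrite (formsP _ (subvsP f)).
rewrite -(@form_evE k (Sub (underlying x) sx) y) // f0 ?mulr0 //.
by rewrite /= cx.
Qed.

Lemma ordering_face k A (x : osimplex G k.+1) l :
  ordering A x -> ordering (A :\ val x l) (face x l).
Proof.
case/orderingP=> xA xpos; have x_inj : injective (val x).
  by have /andP[/injectiveP] := valP x.
have inA i : val x i \in A by rewrite -xA mem_underlying.
apply/orderingP; split.
  apply/setP=> u; rewrite !inE -xA; apply/imsetP/andP=> [[i _ ->]|[ul /imsetP[i _ ui]]].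
    by rewrite ffunE (inj_eq x_inj) eq_sym neq_lift mem_underlying.
  case: (unliftP l i) ui => [j ->|->] uE; first by exists j; rewrite ?ffunE.
  by rewrite uE eqxx in ul.
move=> i; rewrite ffunE; apply/eqP.
rewrite -(eqn_add2l (rho (val x l) < rho (val x (lift l i)))) -posD1 // xpos.
have -> : (rho (val x l) < rho (val x (lift l i)))%N = (l < lift l i)%N.
  rewrite -[in RHS](xpos l) -[in RHS](xpos (lift l i)).
  apply/idP/idP => [|lt_l]; first exact: pos_ltn.
  rewrite ltnNge; apply/negP; rewrite leq_eqVlt => /orP[/eqP/rho_inj/x_inj/eqP|].
    by rewrite eq_sym (negPf (neq_lift _ _)).
  by move/(pos_ltn (inA _)); rewrite ltnNge ltnW.
by apply/eqP; rewrite /= /bump; lia.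
Qed.

(** In an increasing listing the vertex with index [l] has position [l], and deleting it leaves an
    increasing listing; the two alternating sums then agree term by term. *)
Fact form_ev_diff k (a : X) f : cdim a = k.+1 ->
  form_ev k.+1 a (cdiff (form_complex K G) k f) = ext (form_ev k) (bd a) f.
Proof.
move=> ak; have [x ax] := simplex_ordering ak; have /orderingP[xA xpos] := ax.
have x_inj : injective (val x) by have /andP[/injectiveP] := valP x.
rewrite (form_evE _ ax) [LHS]ext_diffE ext_lfunE.
rewrite [bd a]/(sbd _ _ _) linear_sum /= -{1}xA big_imset /=; last by move=> ? ? _ _; apply: x_inj.
apply: eq_big => // l _.
rewrite linearZ /= xpos; congr (_ * _).
have face_l := ordering_face l ax; have /orderingP[fA _] := face_l.
have sA : simplex (val a :\ val x l) by rewrite -fA; have /andP[] := underlying_subproof (face x l).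
by rewrite sdeltaP insubT /= (@form_evE k (Sub _ sA) (face x l)).
Qed.

Definition form_model : model (form_complex K G) X :=
  Model form_ev_dual form_ev_inj form_ev_diff.

End FormModel.

Section ModelTheory.
Variables (K : fieldType) (C : cochain_complex K) (X : cell_complex K).
Variable M : model C X.

Lemma model_basis k : exists b : X -> cobj C k,
  (forall t t', cdim t = k -> cdim t' = k -> ev M k t' (b t) = (t' == t)%:R)
  /\ forall u, u = \sum_(t | cdim t == k) (ev M k t u : K) *: b t.
Proof.
have /fin_all_exists[b bE] (t : X) : exists u : cobj C k,
    cdim t = k -> forall t', cdim t' = k -> ev M k t' u = (t' == t)%:R.
  have [/(ev_dual M)[u uE]|tk] := eqVneq (cdim t) k; first by exists u.
  by exists 0 => /eqP; rewrite (negPf tk).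
exists b; split=> [t t' tk t'k|u]; first exact: bE.
apply/eqP; rewrite -subr_eq0; apply/eqP/(ev_inj (m := M)) => t tk.
rewrite linearB linear_sum /= (bigD1 t) ?tk //= linearZ /= bE // eqxx [_ *: _]mulr1.
rewrite big1 ?addr0 ?subrr // => t' /andP[/eqP t'k t't].
by rewrite linearZ /= bE // eq_sym (negPf t't) scaler0.
Qed.

(** Values on the cells can be prescribed freely, through the dual basis; this is how maps of chains
    are transposed to maps of cochains. *)
Lemma model_pullback (V : vectType K) k (F : X -> 'Hom(V, K^o)) :
  exists f : 'Hom(V, cobj C k), forall t y, cdim t = k -> ev M k t (f y) = F t y.
Proof.
have [b [bE _]] := model_basis k.
pose f y : cobj C k := \sum_(t | cdim t == k) (F t y : K) *: b t.
have f_lin : linear f.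
  move=> a y z; rewrite /f scaler_sumr -big_split; apply: eq_bigr => t _ /=.
  by rewrite linearP scalerDl scalerA.
pose fL := GRing.isLinear.Build K V (cobj C k) _ f f_lin.
pose f' : {linear V -> cobj C k} := HB.pack f fL.
exists (linfun f') => t y tk; rewrite lfunE /= /f linear_sum (bigD1 t) ?tk //=.
rewrite linearZ /= bE // eqxx [_ *: _]mulr1 big1 ?addr0 // => t' /andP[/eqP t'k t't].
by rewrite linearZ /= bE // eq_sym (negPf t't) scaler0.
Qed.

End ModelTheory.

(** * The tensor product of two models *)

Section TensModel.
Variables (K : fieldType) (C D : cochain_complex K).

Section TotEv.
Variables (i j k : nat) (e : (i + j)%N = k).
Variables (phi : 'Hom(cobj C i, K^o)) (psi : 'Hom(cobj D j, K^o)).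

(** The functional phi (x) psi on the component of bidegree (i, j): a tensor is encoded as a map on
    functionals, so it is applied to [phi] first. *)
Definition tot_ev_fun (w : tot_obj C D k) : K^o :=
  psi ((w (mkbideg e) : 'Hom('Hom(cobj C i, K^o), cobj D j)) phi).
Fact tot_ev_linear : linear tot_ev_fun.
Proof.
move=> a w w'; rewrite /tot_ev_fun -linearP; congr (psi _).
by rewrite dsumDE dsumZE add_lfunE scale_lfunE.
Qed.
HB.instance Definition _ :=
  GRing.isLinear.Build K (tot_obj C D k) K^o _ tot_ev_fun tot_ev_linear.
Definition tot_ev : 'Hom(tot_obj C D k, K^o) := linfun tot_ev_fun.

Lemma tot_evE w : tot_ev w =
  psi ((w (mkbideg e) : 'Hom('Hom(cobj C i, K^o), cobj D j)) phi).
Proof. by rewrite lfunE. Qed.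
End TotEv.

Lemma tot_ev_in i j k (e e' : (i + j)%N = k) phi psi u v :
  tot_ev e phi psi (tot_in C D e' (pure u v)) = (phi u : K) * psi v.
Proof.
rewrite (eq_irrelevance e' e) tot_evE tot_inE ffunE dfwith_in.
by rewrite pureE linearZ.
Qed.

Lemma tot_ev_in0 i j i' j' k (e : (i + j)%N = k) (e' : (i' + j')%N = k) phi psi u v :
  i' != i -> tot_ev e phi psi (tot_in C D e' (pure u v)) = 0.
Proof.
move=> ii'; rewrite tot_evE tot_inE ffunE dfwith_out.
  by rewrite zero_lfunE linear0.
by apply: contra ii' => /eqP/(congr1 val)/(congr1 (fun p => val p.1))/= ->.
Qed.

Variables (X Y : cell_complex K) (MX : model C X) (MY : model D Y).

(** The equality test supplies the proof that [tot_ev] needs to select a component; a cell of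
    another dimension evaluates to 0. *)
Definition tens_ev k (t : tens_cells X Y) : 'Hom(cobj (tensor_complex C D) k, K^o) :=
  if @eqP _ (cdim t.1 + cdim t.2)%N k is ReflectT e
  then tot_ev e (ev MX _ t.1) (ev MY _ t.2) else 0.

Lemma tens_ev_bideg k (t : tens_cells X Y) i j (e : (i + j)%N = k) :
  cdim t.1 = i -> cdim t.2 = j -> tens_ev k t = tot_ev e (ev MX i t.1) (ev MY j t.2).
Proof.
move=> t1 t2; case: i / t1 e; case: j / t2 => e.
by rewrite /tens_ev; case: eqP => // e'; rewrite (eq_irrelevance e' e).
Qed.

Lemma tens_evE k (t : tens_cells X Y) i j (e : (i + j)%N = k) u v :
  tens_ev k t (tot_in C D e (pure u v)) =
    if (cdim t.1 == i) && (cdim t.2 == j)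
    then (ev MX i t.1 u : K) * ev MY j t.2 v else 0.
Proof.
have [t1|t1] /= := eqVneq (cdim t.1) i.
  case: eqVneq => [t2|t2]; first by rewrite (tens_ev_bideg e t1 t2) tot_ev_in.
  by rewrite /tens_ev; case: eqP => [e'|_]; rewrite ?zero_lfunE //; lia.
rewrite /tens_ev; case: eqP => [e'|_]; last exact: zero_lfunE.
by rewrite tot_ev_in0 // eq_sym.
Qed.

Fact tens_ev_dual k t : cdim t = k ->
  exists u, forall t', cdim t' = k -> tens_ev k t' u = (t' == t)%:R.
Proof.
move=> tk; have [u uE] := ev_dual MX (erefl (cdim t.1)).
have [v vE] := ev_dual MY (erefl (cdim t.2)).
exists (tot_in C D (tk : (cdim t.1 + cdim t.2)%N = k) (pure u v)) => t' _.
rewrite tens_evE; case: ifP => [/andP[/eqP t1 /eqP t2]|tt'].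
  by rewrite uE // vE // -natrM mulnb.
by case: (eqVneq t' t) tt' => [->|//]; rewrite !eqxx.
Qed.

(** Each [phi] is a combination of evaluations at cells of [X], so a component vanishes once it does
    at all pairs of cells. *)
Fact tens_ev_inj k w : (forall t, cdim t = k -> tens_ev k t w = 0) -> w = 0.
Proof.
move=> w0; apply/ffunP=> p; rewrite dsum0E; have [i [j [e ->]]] := bidegP p.
apply/lfunP=> phi; rewrite zero_lfunE.
have [b [_ bE]] := model_basis MX i.
have -> : phi = \sum_(s | cdim s == i) (phi (b s) : K) *: ev MX i s.
  apply/lfunP=> u; rewrite {1}(bE u) linear_sum sum_lfunE; apply: eq_bigr => s _.
  by rewrite linearZ scale_lfunE; apply: mulrC.
rewrite linear_sum big1 // => s /eqP si; rewrite linearZ /=.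
suff -> : (w (mkbideg e) : 'Hom(_, _)) (ev MX i s) = 0 by rewrite scaler0.
apply: (ev_inj (m := MY)) => t tj; rewrite -tot_evE.
rewrite -(@tens_ev_bideg k (s, t) i j e si tj); apply: w0.
by rewrite /= /tens_dim /= si tj.
Qed.

Lemma ext_bd_dim (Z : cell_complex K) (V : lmodType K) (F : Z -> V) z i :
  ext (fun y => if cdim y == i then F y else 0) (bd z)
    = if cdim z == i.+1 then ext F (bd z) else 0.
Proof.
case: ifPn => zi; last apply: (ext_eq0 (@bd_dim _ Z z)).
  apply: eq_ext (@bd_dim _ Z z) _ => y.
  by rewrite (eqP zi) eqSS eq_sym => ->.
by move=> y /eqP zy; rewrite zy eqSS in zi; rewrite (negPf zi).
Qed.

Lemma ext_box_mul (S T : finType) (f : S -> K^o) (g : T -> K^o) c d :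
  ext (fun p => (f p.1 : K) * g p.2 : K^o) (box c d) = (ext f c : K) * ext g d.
Proof.
rewrite ext_box /= [X in X * _]/ext mulr_suml; apply: eq_bigr => s _.
by rewrite [ext _ d]extZ -[LHS]/(_ * (_ * _)) -[_ *: f s]/(_ * _) mulrA.
Qed.

(** It suffices to test products of cochains, where the Leibniz rules for cochains and for cells
    match: one term survives if [t.1] has dimension [i + 1], the other if it has dimension [i]. *)
Fact tens_ev_diff k t w : cdim t = k.+1 ->
  tens_ev k.+1 t (cdiff (tensor_complex C D) k w) = ext (tens_ev k) (bd t) w.
Proof.
move=> tk; rewrite -comp_lfunE; congr (fun_of_lfun _ w).
apply: tot_ext => i j e u v; rewrite comp_lfunE.
have e1 : (i.+1 + j)%N = k.+1 by rewrite addSn e.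
have e2 : (i + j.+1)%N = k.+1 by rewrite addnS e.
rewrite [X in tens_ev _ _ X](tot_leibniz e e1 e2) linearD linearZ /= !tens_evE.
(* Cutting [u] and [v] off outside their degrees makes evaluation of the product at any pair of
   cells the plain product [f p.1 * g p.2]. *)
pose f s : K^o := if cdim s == i then ev MX i s u else 0.
pose g s : K^o := if cdim s == j then ev MY j s v else 0.
rewrite ext_lfunE (eq_ext (A := xpredT) (F' := fun p : X * Y => (f p.1 : K) * g p.2 : K^o)) //.
  rewrite linearD linearZ /= !ext_box_mul !ext_delta !ext_bd_dim.
  rewrite -!ext_lfunE.
  have [t1|t1] := eqVneq (cdim t.1) i.+1.
    rewrite -(ev_diff MX) // /f t1 (gtn_eqF (ltnSn i)) /= mul0r !scaler0 !addr0.
    by rewrite /g; case: ifP; rewrite ?mulr0.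
  rewrite mul0r /= !add0r /f /g; case: eqVneq => [->|_]; last by rewrite mul0r !scaler0.
  by case: eqVneq => [t2|_]; rewrite ?mulr0 // (ev_diff MY).
move=> p _; rewrite tens_evE /f /g; case: eqVneq => _ /=; last by rewrite mul0r.
by case: ifP; rewrite ?mulr0.
Qed.

Definition tens_model : model (tensor_complex C D) (tens_cells X Y) :=
  Model tens_ev_dual tens_ev_inj tens_ev_diff.


End TensModel.

(** * Induced maps in cohomology *)

Section QuotientMaps.
Variable K : fieldType.

Lemma lquot_map (V W : vectType K) (S : {vspace V}) (T : {vspace W})
    (f : {linear V -> W}) : (forall x, x \in S -> f x \in T) ->
  exists F : {linear lquot S -> lquot T}, forall x, F (lquot_pi S x) = lquot_pi T (f x).
Proof.
move=> fST; pose F (q : lquot S) : lquot T := lquot_pi T (f (repr (q : Quotient.quot S))).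
have FE x : F (lquot_pi S x) = lquot_pi T (f x).
  apply/lquot_piP; rewrite -linearB; apply: fST; apply/lquot_piP.
  by rewrite /lquot_pi reprK.
have F_lin : linear F.
  move=> a p q; have [x <-] := lquot_pi_surj p; have [y <-] := lquot_pi_surj q.
  by rewrite -linearP !FE !linearP.
pose FL := GRing.isLinear.Build K (lquot S) (lquot T) _ F F_lin.
by exists (HB.pack F FL : {linear lquot S -> lquot T}).
Qed.

Lemma lquot_iso (V W : vectType K) (S : {vspace V}) (T : {vspace W})
    (f : {linear V -> W}) (g : {linear W -> V}) :
    (forall x, x \in S -> f x \in T) -> (forall y, y \in T -> g y \in S) ->
    (forall x, g (f x) - x \in S) -> (forall y, f (g y) - y \in T) ->
  lmod_iso (lquot S) (lquot T).
Proof.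
move=> fST gTS gfK fgK; have [F FE] := lquot_map fST; have [G GE] := lquot_map gTS.
exists F; exists G => q.
  by have [x <-] := lquot_pi_surj q; rewrite FE GE; apply/lquot_piP.
by have [x <-] := lquot_pi_surj q; rewrite GE FE; apply/lquot_piP.
Qed.

(** The maps need only be inverse modulo coboundaries on cocycles. They are restricted to the
    subspaces of cocycles, on which [cohomology] is a quotient. *)
Lemma cohomology_iso (C D : cochain_complex K) k
    (f : 'Hom(cobj C k, cobj D k)) (g : 'Hom(cobj D k, cobj C k)) :
    (forall x, x \in cocycles C k -> f x \in cocycles D k) ->
    (forall y, y \in cocycles D k -> g y \in cocycles C k) ->
    (forall x, x \in coboundaries C k -> f x \in coboundaries D k) ->
    (forall y, y \in coboundaries D k -> g y \in coboundaries C k) ->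
    (forall x, x \in cocycles C k -> g (f x) - x \in coboundaries C k) ->
    (forall y, y \in cocycles D k -> f (g y) - y \in coboundaries D k) ->
  lmod_iso (cohomology C k) (cohomology D k).
Proof.
move=> fZ gZ fB gB gfB fgB.
pose f' : 'Hom(subvs_of (cocycles C k), subvs_of (cocycles D k)) :=
  (linfun (vsproj (cocycles D k)) \o f \o linfun vsval)%VF.
pose g' : 'Hom(subvs_of (cocycles D k), subvs_of (cocycles C k)) :=
  (linfun (vsproj (cocycles C k)) \o g \o linfun vsval)%VF.
have f'E (x : subvs_of (cocycles C k)) : vsval (f' x) = f (vsval x).
  by rewrite !comp_lfunE !lfunE /= vsprojK //; apply/fZ/subvsP.
have g'E (y : subvs_of (cocycles D k)) : vsval (g' y) = g (vsval y).
  by rewrite !comp_lfunE !lfunE /= vsprojK //; apply/gZ/subvsP.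
apply: (@lquot_iso _ _ _ _ f' g') => [x|y|x|y]; rewrite -!memv_preim !lfunE /=.
- by rewrite f'E; apply: fB.
- by rewrite g'E; apply: gB.
- by rewrite g'E f'E; apply/gfB/subvsP.
- by rewrite f'E g'E; apply/fgB/subvsP.
Qed.

End QuotientMaps.

Section ModelMaps.
Variable K : fieldType.

Section Pairing.
Variables (C : cochain_complex K) (X : cell_complex K) (M : model C X).

Lemma ext_ev_diff k c u : supported (fun t => cdim t == k.+1) c ->
  ext (ev M k.+1) c (cdiff C k u) = ext (ev M k) (ext (@bd _ X) c) u.
Proof.
move=> ck; rewrite [ext _ (ext _ _)]ext_comp !ext_lfunE.
by apply: eq_ext ck _ => t /eqP tk; rewrite (ev_diff M).
Qed.

(* Dual to a chain homotopy s from h to the identity. *)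
Lemma homotopy_coboundary (h s : X -> chain K X) k x x' :
    (forall t, supported (fun u => cdim u == (cdim t).+1) (s t)) ->
    (forall t, ext (@bd _ X) (s t) + ext s (bd t) = h t - delta K t) ->
    x \in cocycles C k ->
    (forall t, cdim t = k -> ev M k t x' = ext (ev M k) (h t) x) ->
  x' - x \in coboundaries C k.
Proof.
move=> s_dim s_bd; rewrite memv_ker => /eqP dx0 x'E.
(* Since [x] is a cocycle it vanishes on the boundary of [s t], which leaves only the term
   [s (bd t)] of the homotopy. *)
have dE t : cdim t = k -> ev M k t (x' - x) = ext (ev M k) (ext s (bd t)) x.
  move=> tk; rewrite linearB /= x'E // -(subrK (delta K t) (h t)) -s_bd.
  rewrite !linearD /= !add_lfunE ext_delta addrK -ext_ev_diff ?dx0 ?linear0 ?add0r //.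
  by rewrite -tk.
(* In degree 0 the only coboundary is 0, and [x' = x] because vertices have no boundary; in higher
   degree the primitive is [x] composed with [s]. *)
case: k => [|k] in x x' dx0 x'E dE *.
  rewrite memv0; apply/eqP/(ev_inj (m := M)) => t t0.
  by rewrite dE // bd_dim0 // !linear0 zero_lfunE.
have [f fE] := model_pullback M k (fun t => ext (ev M k.+1) (s t)).
suff -> : x' - x = cdiff C k (f x) by rewrite memv_img ?memvf.
apply/eqP; rewrite -subr_eq0; apply/eqP/(ev_inj (m := M)) => t tk.
rewrite linearB /= dE // (ev_diff M) //; apply/eqP; rewrite subr_eq0; apply/eqP.
rewrite [ext _ (ext _ _)]ext_comp !ext_lfunE.
apply: eq_ext (@bd_dim _ X t) _ => u; rewrite tk eqSS => /eqP uk.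
by rewrite fE.
Qed.

End Pairing.

Section Pullback.
Variables (C D : cochain_complex K) (X Y : cell_complex K).
Variables (M : model C X) (N : model D Y) (f : X -> chain K Y).
Hypothesis f_dim : forall t, supported (fun u => cdim u == cdim t) (f t).
Hypothesis f_bd : forall t, ext (@bd _ Y) (f t) = ext f (bd t).

(** The transpose of the chain map [f] in degree [k]. *)
Definition is_pullback k (g : 'Hom(cobj D k, cobj C k)) := forall t y,
  cdim t = k -> ev M k t (g y) = ext (ev N k) (f t) y.

Lemma is_pullback_ext k g c y : @is_pullback k g ->
  supported (fun t => cdim t == k) c ->
  ext (ev M k) c (g y) = ext (ev N k) (ext f c) y.
Proof.
move=> gP ck; rewrite [ext _ (ext _ _)]ext_comp !ext_lfunE.
by apply: eq_ext ck _ => t /eqP; apply: gP.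
Qed.

Lemma is_pullback_diff k g g' y : @is_pullback k g -> @is_pullback k.+1 g' ->
  g' (cdiff D k y) = cdiff C k (g y).
Proof.
move=> gP g'P; apply/eqP; rewrite -subr_eq0; apply/eqP/(ev_inj (m := M)) => t tk.
apply/eqP; rewrite linearB /= subr_eq0 g'P // (ev_diff M) // ext_ev_diff -?tk // f_bd.
rewrite is_pullback_ext //; apply: sub_supported (@bd_dim _ X t) => u.
by rewrite tk eqSS eq_sym.
Qed.

Lemma pullback_exists k : exists g, @is_pullback k g.
Proof. exact: (model_pullback M k (fun t => ext (ev N k) (f t))). Qed.

Lemma pullback_cocycles k g y : @is_pullback k g ->
  y \in cocycles D k -> g y \in cocycles C k.
Proof.
move=> gP; rewrite !memv_ker => /eqP dy; have [g' g'P] := pullback_exists k.+1.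
by rewrite -(is_pullback_diff _ gP g'P) dy linear0.
Qed.

Lemma pullback_coboundaries k g y : @is_pullback k g ->
  y \in coboundaries D k -> g y \in coboundaries C k.
Proof.
case: k => [|k] in g y *; first by rewrite !memv0 => _ /eqP->; rewrite linear0.
move=> gP /memv_imgP[z _ ->]; have [h hP] := pullback_exists k.
by rewrite (is_pullback_diff _ hP gP) memv_img ?memvf.
Qed.

End Pullback.

Theorem carried_cohomology_iso (C D : cochain_complex K) (X Y : cell_complex K)
    (P : Type) (le : rel P) : reflexive le -> transitive le ->
    model C X -> model D Y -> carried X le -> carried Y le ->
  forall k, lmod_iso (cohomology C k) (cohomology D k).
Proof.
move=> le_refl le_trans M N cX cY k.
have [f fP] := carried_lift le_trans cX cY.
have [g gP] := carried_lift le_trans cY cX.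
have [s sP] := carried_homotopy le_trans
  (carried_comp le_trans fP gP) (carried_id le_refl cX).
have [s' s'P] := carried_homotopy le_trans
  (carried_comp le_trans gP fP) (carried_id le_refl cY).
have f_dim t : supported (fun u => cdim u == cdim t) (f t).
  by have [+ _ _] := fP t; apply: sub_supported => u /andP[].
have g_dim t : supported (fun u => cdim u == cdim t) (g t).
  by have [+ _ _] := gP t; apply: sub_supported => u /andP[].
have f_bd t : ext (@bd _ Y) (f t) = ext f (bd t) by have [] := fP t.
have g_bd t : ext (@bd _ X) (g t) = ext g (bd t) by have [] := gP t.
(* Transposition reverses direction: [g'] goes from [C] to [D] and [f'] back. *)
have [f' f'P] := pullback_exists M N f k.
have [g' g'P] := pullback_exists N M g k.
apply: (@cohomology_iso _ _ _ _ g' f').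
- by move=> x; apply: (pullback_cocycles g_dim g_bd g'P).
- by move=> y; apply: (pullback_cocycles f_dim f_bd f'P).
- by move=> x; apply: (pullback_coboundaries g_dim g_bd g'P).
- by move=> y; apply: (pullback_coboundaries f_dim f_bd f'P).
- move=> x xZ; apply: (homotopy_coboundary (M := M) (h := fun t => ext g (f t))
    (fun t => (sP t).1) (fun t => (sP t).2) xZ).
  by move=> t tk; rewrite f'P // (is_pullback_ext _ g'P) // -tk.
move=> y yZ; apply: (homotopy_coboundary (M := N) (h := fun t => ext f (g t))
  (fun t => (s'P t).1) (fun t => (s'P t).2) yZ).
by move=> t tk; rewrite g'P // (is_pullback_ext _ f'P) // -tk.
Qed.

End ModelMaps.

(** * Chains of pairs of simplices, and the comparison *)

Lemma injective_refinement (T : finType) (h : T -> nat) :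
  exists2 rho : T -> nat, injective rho & forall x y, (h x < h y)%N -> (rho x < rho y)%N.
Proof.
(* A two-digit number in base [#|T|]: [h x] leads and the rank of [x] breaks ties. *)
pose rho x := (h x * #|T| + enum_rank x)%N.
have rho_div x : (rho x %/ #|T|)%N = h x.
  have T0 : (0 < #|T|)%N by apply/card_gt0P; exists x.
  by rewrite divnMDl // divn_small ?addn0.
exists rho => [x y xy|x y hxy].
  apply: enum_rank_inj; apply: val_inj => /=.
  by have := xy; rewrite /rho -(rho_div x) xy rho_div => /addnI.
apply: (@leq_trans ((h x).+1 * #|T|)); first by rewrite /rho mulSn addnC ltn_add2r.
by apply: leq_trans (leq_addr _ _); rewrite leq_mul2r hxy orbT.
Qed.

Section ProductCarried.
Variables (K : fieldType) (G H : sgraph) (rho : prod_graph G H -> nat).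
Hypothesis rho_inj : injective rho.

Definition pair_le : rel (simplices G * simplices H) :=
  prod_le (@face_le G) (@face_le H).

Lemma pair_le_refl : reflexive pair_le.
Proof. by move=> p; rewrite /pair_le /prod_le /face_le !subxx. Qed.

Lemma pair_le_trans : transitive pair_le.
Proof.
move=> q p r /andP[pq1 pq2] /andP[qr1 qr2].
by rewrite /pair_le /prod_le /face_le (subset_trans pq1 qr1) (subset_trans pq2 qr2).
Qed.

(** Larger pairs come first, so that the apex of a cone, the largest pair, precedes the rest of the
    chain. *)
Hypothesis rho_anti : forall p q, p != q -> pair_le p q -> (rho q < rho p)%N.

(** Vertices of a simplex of the product graph are pairwise comparable, so the simplex is a chain,
    and its first vertex is its maximum. *)
Lemma first_top (a : simplices (prod_graph G H)) p :
  p \in val a -> pair_le p (first rho a).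
Proof.
move=> pa; have [->|pf] := eqVneq p (first rho a); first exact: pair_le_refl.
have /andP[_ /orP[//|fp]] := simplex_adj (valP a) pa (first_in rho a) pf.
have := rho_anti (p := first rho a) (q := p); rewrite eq_sym => /(_ pf fp).
by rewrite ltnNge ltnW // first_min.
Qed.

(** The carrier of a chain is its maximum. A chain below [p] stays a chain below [p] when [p] is
    added, so [p] is its own apex. *)
Definition product_carried : carried (simplex_cells K rho_inj) pair_le.
Proof.
apply: (@simplex_carried _ _ _ _ _ _ (first rho) (fun p => p)).
- by move=> a b /subsetP ab; apply/first_top/ab/first_in.
- move=> p a ap; suff -> : first rho a = p by apply: pair_le_refl.
  by apply/set1P; rewrite -ap first_in.
- move=> p a ap; have pa u : u \in val a -> pair_le u p.
    by move/first_top => uf; apply: pair_le_trans uf ap.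
  apply: simplexP => [|u v]; first by apply/set0Pn; exists p; rewrite setU11.
  rewrite !inE => /orP[/eqP->|ua] /orP[/eqP->|va] uv.
  + by rewrite eqxx in uv.
  + by apply/andP; split=> //; apply/orP; right; apply: pa.
  + by apply/andP; split=> //; apply/orP; left; apply: pa.
  by apply: simplex_adj (valP a) ua va uv.
- move=> p a b ap bE; have := first_in rho b; rewrite bE !inE.
  case/orP=> [/eqP->|/first_top fb]; first exact: pair_le_refl.
  exact: pair_le_trans fb ap.
move=> p a u ap ua up; apply: rho_anti => //.
exact: pair_le_trans (first_top ua) ap.
Qed.

End ProductCarried.

Theorem theorem5 (R : realType) (G H : sgraph) (k : nat) :
  lmod_iso (cohomology (de_rham_complex R G H) k)
           (cohomology (form_complex R (prod_graph G H)) k).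
Proof.
have [rG rG_inj _] := @injective_refinement G (fun=> 0).
have [rH rH_inj _] := @injective_refinement H (fun=> 0).
(* Codimension within the vertex sets, summed over both factors, decreases as pairs grow; this
   yields the reversed order. *)
have [r r_inj r_lt] := @injective_refinement (prod_graph G H)
  (fun p => (#|G| - #|val p.1|) + (#|H| - #|val p.2|))%N.
have r_anti p q : p != q -> @pair_le G H p q -> (r q < r p)%N.
  move=> pq /andP[pq1 pq2]; apply: r_lt.
  have cG : (#|val q.1| <= #|G|)%N := max_card _.
  have cH : (#|val q.2| <= #|H|)%N := max_card _.
  have c1 : (#|val p.1| <= #|val q.1|)%N := subset_leq_card pq1.
  have c2 : (#|val p.2| <= #|val q.2|)%N := subset_leq_card pq2.
  (* Comparable distinct pairs differ in the size of some component, since nested sets of equal size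
     coincide. *)
  suff : (#|val p.1| != #|val q.1|) || (#|val p.2| != #|val q.2|).
    move: cG cH c1 c2.
    move: #|val p.1| #|val p.2| #|val q.1| #|val q.2| #|G| #|H| => *; lia.
  apply: contraR pq; rewrite negb_or !negbK => /andP[/eqP e1 /eqP e2].
  have h1 : p.1 = q.1 by apply/val_inj/eqP; rewrite eqEcard e1 leqnn andbT.
  have h2 : p.2 = q.2 by apply/val_inj/eqP; rewrite eqEcard e2 leqnn andbT.
  by rewrite [p]surjective_pairing h1 h2 -surjective_pairing.
apply: (carried_cohomology_iso (@pair_le_refl G H) (@pair_le_trans G H)
  (tens_model (form_model R rG_inj) (form_model R rH_inj)) (form_model R r_inj)
  _ (product_carried R r_inj r_anti)).
apply: tens_carried; [by move=> a; apply: subxx | by move=> a; apply: subxx | |].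
  exact: face_carried.
exact: face_carried.
Qed.
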